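(* Let $\Sigma=\{1,\dots,k\}$, $W=12\cdots k$, and consider the associated frog dynamics. Then the frogs' speeds satisfy $$s_m=\frac{k+1}{(k+2-m)(k+1-m)}\qquad (m=1,\dots,k).$$ In particular, for $\rho=1$, we have $\gamma_W(1)=\min_{t\in\mathbb{Z}_+}\frac{k+t^2}{k(t+1)}$, and $\tau_W(1)$ is nonzero precisely when $k$ is of the form $r^2+r-1$ for some $r\in\mathbb{Z}_+$. Here $\gamma_W(1)$ and $\tau_W(1)$ are the constants for which $\mathbb{E}_{R\sim\Sigma^n}\mathrm{LCS}(R,W^{(n)})=\gamma_W(1)\,n-\tau_W(1)\sqrt n+O(1)$ as $n\to\infty$.
   Context: $k$ is a positive integer and $\mathbb{Z}_+$ denotes the positive integers. Words: a word is a finite sequence of symbols from a finite alphabet $\Sigma$, indexed from $0$; $R\sim\Sigma^n$ means $R$ is uniformly random in $\Sigma^n$. $\mathrm{LCS}(V,V')$ is the length of the longest common (not necessarily contiguous) subsequence of $V$ and $V'$. For a word $W$ of length $k$, $W^{(n)}$ is the word of length $n$ with $i$-th symbol $W_{i\bmod k}$. Frog dynamics: let $W=W_0\cdots W_{k-1}\in\Sigma^k$. There are $k$ lily pads indexed by $\mathbb{Z}/k\mathbb{Z}$, pad $i$ being labeled $W_i$, and $k$ frogs $f_1,\dots,f_k$, where $f_i$ is nastier than $f_j$ iff $i<j$. A frog arrangement is a bijection $F:\{f_1,\dots,f_k\}\to\mathbb{Z}/k\mathbb{Z}$. For a symbol $c\in\Sigma$, the arrangement $Fc$ is obtained as follows.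 Initially, the agitated frogs are exactly those sitting on pads labeled $c$. As long as some frog is agitated, let $f_m$ be the nastiest agitated frog, currently on pad $x$; it leaves $x$ and leaps to pad $x+y$, where $y\in\{1,\dots,k\}$ is the least integer such that pad $x+y$ is not currently occupied by a frog nastier than $f_m$; then $f_m$ calms down and any other frog currently on pad $x+y$ becomes agitated. (Each frog moves at most once.) The final positions form the arrangement $Fc$. Put $D_m(F,c)=y$ if $f_m$ leapt (by $y$) during this process and $D_m(F,c)=0$ otherwise. For a word $R=R_0\cdots R_{\ell-1}$, $FR=(\cdots((FR_0)R_1)\cdots)R_{\ell-1}$, and $D_m(F,R)=\sum_{t=0}^{\ell-1}D_m(FR_0\cdots R_{t-1},R_t)$. The speed of frog $f_m$ is $s_m=\lim_{n\to\infty}\frac1n\mathbb{E}_{R\sim\Sigma^n}D_m(F_0,R)$ (it exists and is independent of the initial arrangement $F_0$).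
   Formalization: The clause that τ_W(1) is nonzero precisely when k = r²+r−1 is proved for k > 1 only: at k = 1 we have LCS(R,W^(n)) = n, so τ_W(1) = 0 although 1 = 1²+1−1. *)

(* Defs.v *)
From HB Require Import structures.
From mathcomp Require Import all_boot all_order all_algebra.
From mathcomp Require Import all_classical all_reals all_analysis.

Set Implicit Arguments.
Unset Strict Implicit.
Unset Printing Implicit Defensive.

Import Order.TTheory GRing.Theory Num.Theory.
Import numFieldNormedType.Exports.

Local Open Scope classical_set_scope.
Local Open Scope ring_scope.

(* The residue of [i] modulo [k]; Z/kZ is represented by ['I_k]. *)
Definition residue (k : nat) (hk : (0 < k)%N) (i : nat) : 'I_k :=
  Ordinal (ltn_pmod i hk).

Section Words.
Variable Sigma : finType.

Definition lcs (V V' : seq Sigma) : nat :=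
  (\max_(l < (size V).+1 |
         [exists s : l.-tuple Sigma, subseq s V && subseq s V']) l)%N.

Definition periodic_word (k : nat) (hk : (0 < k)%N) (W : k.-tuple Sigma)
    (n : nat) : n.-tuple Sigma :=
  [tuple tnth W (residue hk i) | i < n].

Definition expect_word (R : realType) (n : nat) (X : n.-tuple Sigma -> nat) : R :=
  (\sum_(r : n.-tuple Sigma) (X r)%:R) / #|{: n.-tuple Sigma}|%:R.

(* E LCS(r, W^(n)) = gamma n - tau sqrt n + O(1), with r uniform in Sigma^n. *)
Definition lcs_asymptotics (R : realType) (k : nat) (hk : (0 < k)%N)
    (W : k.-tuple Sigma) (gamma tau : R) : Prop :=
  (fun n : nat =>
     expect_word R (fun r : n.-tuple Sigma => lcs r (periodic_word hk W n))
     - (gamma * n%:R - tau * Num.sqrt n%:R) : R^o)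
  =O_\oo (fun=> 1 : R^o).

End Words.

Section FrogDynamics.
Variables (Sigma : finType) (k : nat) (hk : (0 < k)%N) (W : k.-tuple Sigma).

(* Frog [f_(m+1)] is represented by [m : 'I_k], so smaller means nastier.
   A position map sends each frog to its pad; it is an arrangement when it is
   a bijection.  While frogs are moving, two frogs may share a pad. *)
Definition positions : Type := {ffun 'I_k -> 'I_k}.

Record frog_state := FrogState {
  pos : positions;
  agitated : {set 'I_k};
  leapt : {ffun 'I_k -> nat}
}.

Definition nastiest (A : {set 'I_k}) : option 'I_k :=
  [pick m in A | [forall j in A, (m <= j)%N]].

Definition held_by_nastier (P : positions) (m x : 'I_k) : bool :=
  [exists j : 'I_k, (j < m)%N && (P j == x)].

(* The least [y] in [1, k] such that pad [P m + y] is free of nastier frogs.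
   Such a [y] exists, since fewer than [k] frogs are nastier than [m]. *)
Definition leap (P : positions) (m : 'I_k) : nat :=
  (find (fun y => ~~ held_by_nastier P m (residue hk (P m + y))) (iota 1 k)).+1.

Definition frog_step (S : frog_state) : frog_state :=
  if nastiest (agitated S) is Some m then
    let y := leap (pos S) m in
    let z := residue hk (pos S m + y) in
    FrogState
      [ffun j => if j == m then z else pos S j]
      [set j | (j != m) && ((j \in agitated S) || (pos S j == z))]
      [ffun j => if j == m then y else leapt S j]
  else S.

Definition initial_state (F : positions) (c : Sigma) : frog_state :=
  FrogState F [set m | tnth W (F m) == c] [ffun=> 0%N].

(* A leaping frog only agitates less nasty ones, so each frog leaps at most
   once and after [k] steps no frog is agitated. *)
Definition final_state (F : positions) (c : Sigma) : frog_state :=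
  iter k frog_step (initial_state F c).

Definition act (F : positions) (c : Sigma) : positions := pos (final_state F c).

Definition act_word (F : positions) (r : seq Sigma) : positions := foldl act F r.

Definition displacement (m : 'I_k) (F : positions) (c : Sigma) : nat :=
  leapt (final_state F c) m.

Definition total_displacement (m : 'I_k) (n : nat) (F : positions)
    (r : n.-tuple Sigma) : nat :=
  (\sum_(t < n) displacement m (act_word F (take t r)) (tnth r t))%N.

(* The limit defining the speed exists and equals [s], for every initial
   arrangement. *)
Definition has_speed (R : realType) (m : 'I_k) (s : R) : Prop :=
  forall F0 : positions, bijective F0 ->
    (fun n : nat => expect_word R (@total_displacement m n F0) / n%:R : R)
      @ \oo --> s.

End FrogDynamics.

(* Main.v *)
Require Import Defs.
From mathcomp Require Import all_boot all_order all_algebra.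
From mathcomp Require Import all_classical all_reals all_analysis.
From mathcomp Require Import ring lra zify.
Import Order.TTheory GRing.Theory Num.Theory.
Import numFieldNormedType.Exports.
Local Open Scope ring_scope.
Set Implicit Arguments.
Unset Strict Implicit.
Unset Printing Implicit Defensive.

(* A letter pokes a single pad [c], and the displacements telescope: the [m] nastiest frogs
   together leap the distance from [c] to the first pad outside the set they hold.  This set
   is a Markov chain for which the uniform distribution on [m]-subsets is stationary, because
   (set, poked pad) -> (new set, landing pad) is injective.  Counting gives the mean distance
   m / (k + 1 - m), and the speeds are the differences of these numbers.

   Lift the frogs to the line, frog [m] starting at [m].  Their order is preserved, and the
   first row differences of the LCS table of R against W^(oo) equal 1 exactly at the sites
   that the frog holding their residue has already passed.  Hence LCS(R, W^(n)) is, up to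
   O(1), the sum over the frogs of min(n, D_m) / k = (n + D_m - |D_m - n|) / (2 k).

   It remains to see that E |D_m - n| = |s_m - 1| n + c_m sqrt n + O(1), with c_m > 0 exactly
   when s_m = 1.  The Poisson equation turns D_m - s_m n into a martingale with bounded
   increments, up to O(1).  The expected absolute value of such a martingale is compared with
   the explicit solution V(t, x) of the heat equation with V(0, x) = kappa |x|.  After a second
   order correction for the variance of the increments, the error at time t is
   O(1 / (t + x^2)) + O(t^(-3/2)); the bounded functions t / (3 t + x^2) and t^(-1/2) are
   strict super- and subsolutions absorbing it, so that no logarithm is lost.

   Finally s_m = (k + 1) / (u (u + 1)) with u = k - m (m counted from 0), so that s_m = 1 iff
   k = u^2 + u - 1, and the sum of the min(1, s_m) is a minimum over the place where the
   speeds cross 1. *)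

(** * Averages over random words *)

Section Average.
Variables (R : realType) (C : finType).
Hypothesis C_gt0 : (0 < #|C|)%N.

Definition avg (f : C -> R) : R := (\sum_c f c) / #|C|%:R.

(** Conditioning on the first letter is definitional in this form, which suits inductions along a
    chain with an arbitrary starting state. *)
Fixpoint avgn (n : nat) (X : seq C -> R) : R :=
  if n is n'.+1 then avg (fun c => avgn n' (fun r => X (c :: r))) else X [::].

Let card_neq0 : #|C|%:R != 0 :> R.
Proof. by rewrite pnatr_eq0 -lt0n. Qed.

Lemma eq_avg f g : f =1 g -> avg f = avg g.
Proof. by move=> fg; rewrite /avg (eq_bigr g). Qed.

Lemma avgD f g : avg (fun c => f c + g c) = avg f + avg g.
Proof. by rewrite /avg big_split mulrDl. Qed.

Lemma avgM a f : avg (fun c => a * f c) = a * avg f.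
Proof. by rewrite /avg -mulr_sumr mulrA. Qed.

Lemma avgN f : avg (fun c => - f c) = - avg f.
Proof. by rewrite /avg sumrN mulNr. Qed.

Lemma avgB f g : avg (fun c => f c - g c) = avg f - avg g.
Proof. by rewrite avgD avgN. Qed.

Lemma avg_cst a : avg (fun=> a) = a.
Proof. by rewrite /avg sumr_const -[X in X / _]mulr_natr; exact: (mulfK card_neq0). Qed.

Lemma le_avg f g : (forall c, f c <= g c) -> avg f <= avg g.
Proof.
by move=> fg; rewrite /avg ler_wpM2r ?invr_ge0 // ler_sum.
Qed.

Lemma avg_eq_max f a : (forall c, f c <= a) -> avg f = a -> forall c, f c = a.
Proof.
move=> fa fE c; apply/eqP; rewrite -subr_eq0 -oppr_eq0 opprB.
have /eqP : \sum_c (a - f c) = 0.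
  have : avg (fun c => a - f c) = 0 by rewrite avgB avg_cst fE subrr.
  by move/eqP; rewrite mulf_eq0 invr_eq0 (negbTE card_neq0) orbF => /eqP.
rewrite psumr_eq0 => [/allP/(_ c)|i _]; last by rewrite subr_ge0.
by rewrite mem_index_enum => /(_ isT).
Qed.

Lemma eq_avgn n (X Y : seq C -> R) :
  (forall r, size r = n -> X r = Y r) -> avgn n X = avgn n Y.
Proof.
elim: n X Y => [|n IH] X Y XY /=; first exact: XY.
by apply: eq_avg => c; apply: IH => r rn; apply: XY; rewrite /= rn.
Qed.

Lemma le_avgn n (X Y : seq C -> R) :
  (forall r, size r = n -> X r <= Y r) -> avgn n X <= avgn n Y.
Proof.
elim: n X Y => [|n IH] X Y XY /=; first exact: XY.
by apply: le_avg => c; apply: IH => r rn; apply: XY; rewrite /= rn.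
Qed.

Lemma avgnD n (X Y : seq C -> R) :
  avgn n (fun r => X r + Y r) = avgn n X + avgn n Y.
Proof.
elim: n X Y => [|n IH] X Y //=.
by rewrite -avgD; apply: eq_avg => c; rewrite IH.
Qed.

Lemma avgnM n a (X : seq C -> R) : avgn n (fun r => a * X r) = a * avgn n X.
Proof.
elim: n X => [|n IH] X //=.
by rewrite -avgM; apply: eq_avg => c; rewrite IH.
Qed.

Lemma avgn_cst n a : avgn n (fun=> a) = a.
Proof. by elim: n => //= n IH; rewrite (eq_avg (g := fun=> a)) ?avg_cst. Qed.

Lemma avgnN n (X : seq C -> R) : avgn n (fun r => - X r) = - avgn n X.
Proof.
by rewrite -mulN1r -avgnM; apply: eq_avgn => r _; rewrite mulN1r.
Qed.

Lemma avgnB n (X Y : seq C -> R) :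
  avgn n (fun r => X r - Y r) = avgn n X - avgn n Y.
Proof. by rewrite avgnD avgnN. Qed.

Lemma avgn_sum n (I : finType) (X : I -> seq C -> R) :
  avgn n (fun r => \sum_i X i r) = \sum_i avgn n (X i).
Proof.
elim: n X => [|n IH] X //=.
rewrite (eq_avg (g := fun c => \sum_i avgn n (fun r => X i (c :: r)))); last first.
  by move=> c; rewrite IH.
by rewrite /avg exchange_big /= mulr_suml.
Qed.

Lemma avgn_close n (X Y : seq C -> R) e :
  (forall r, size r = n -> `|X r - Y r| <= e) -> `|avgn n X - avgn n Y| <= e.
Proof.
move=> XY; rewrite -avgnB ler_norml; apply/andP; split.
  rewrite -(avgn_cst n (- e)); apply: le_avgn => r /XY.
  by rewrite ler_norml => /andP[].
rewrite -[leRHS](avgn_cst n); apply: le_avgn => r /XY.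
by rewrite ler_norml => /andP[].
Qed.

Lemma sum_tuple_cons n (X : seq C -> R) :
  \sum_(r : n.+1.-tuple C) X r = \sum_c \sum_(r : n.-tuple C) X (c :: r).
Proof.
rewrite pair_big /=.
rewrite (reindex (fun p : C * n.-tuple C => [tuple of p.1 :: p.2])) /=; last first.
  exists (fun r : n.+1.-tuple C => (thead r, [tuple of behead r])) => /=.
    by move=> [c r] _ /=; congr (_, _); apply: val_inj.
  by move=> r _; rewrite -tuple_eta.
by apply: eq_bigr.
Qed.

Lemma sum_tuple_avgn n (X : seq C -> R) :
  (\sum_(r : n.-tuple C) X r) / (#|C| ^ n)%:R = avgn n X.
Proof.
elim: n X => [|n IH] X /=.
  rewrite expn0 divr1 (big_pred1 [tuple]) // => r.
  by apply/esym/eqP/val_inj => /=; case: r => -[].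
rewrite sum_tuple_cons /avg mulr_suml.
rewrite mulr_suml; apply: eq_bigr => c _.
by rewrite -IH expnSr natrM invfM mulrA.
Qed.

Lemma expect_wordE n (X : n.-tuple C -> nat) (Y : seq C -> nat) :
  (forall r, X r = Y r) -> expect_word R X = avgn n (fun r => (Y r)%:R).
Proof.
move=> XY; rewrite -sum_tuple_avgn /expect_word card_tuple.
by congr (_ / _); apply: eq_bigr => r _; rewrite XY.
Qed.

End Average.

(** * Chains with a state reachable from every state *)

Section Chain.
Variables (R : realType) (C : finType) (C_gt0 : (0 < #|C|)%N).
Variables (T : finType) (step : T -> C -> T) (o : T).
Hypothesis reach : forall x, exists w, foldl step x w = o.

Implicit Types (h g : T -> R).

Definition markov h x := avg (fun c => h (step x c)).

(* The set where a subharmonic function is maximal is closed under the dynamics, so that it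
   contains [o]. *)
Lemma harmonic_le h : (forall x, h x <= markov h x) -> forall x, h x <= h o.
Proof.
move=> hh.
pose a := \big[Order.max/h o]_x h x.
have ha x : h x <= a by apply: le_bigmax.
have [x0 x0a] : exists x, h x = a.
  apply: (big_ind (fun b => exists x, h x = b)).
  - by exists o.
  - by move=> u v [x hx] [y hy]; rewrite /Order.max; case: ifP => _; [exists y|exists x].
  - by move=> x _; exists x.
suff oa : h o = a by move=> x; rewrite oa.
have [w wo] := reach x0; rewrite -wo {wo}.
elim: w x0 x0a => [|c w IH] x xa //=; apply: IH.
apply: (avg_eq_max C_gt0 (f := fun c => h (step x c))) => //.
apply/eqP; rewrite eq_le; apply/andP; split.
  by rewrite -[leRHS](avg_cst C_gt0); apply: le_avg.
by rewrite -xa; apply: hh.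
Qed.

(* The linear map [h |-> h - markov h + h o] is injective by the maximum principle, hence
   surjective. *)
Lemma poisson g : exists gbar h, forall x, g x = gbar + h x - markov h x.
Proof.
(* Functions are row vectors and [Q] multiplies on the right, so the column index is the point of
   evaluation. *)
pose Q : 'M[R]_#|T| := \matrix_(i, j)
  ((i == j)%:R - (#|[set c | step (enum_val j) c == enum_val i]|%:R / #|C|%:R)
   + (enum_val i == o)%:R).
have rv h : exists u : 'rV[R]_#|T|, forall x, u ord0 (enum_rank x) = h x.
  by exists (\row_i h (enum_val i)) => x; rewrite mxE enum_rankK.
have QE (u : 'rV[R]_#|T|) (h := fun x => u ord0 (enum_rank x)) x :
    (u *m Q) ord0 (enum_rank x) = h x - markov h x + h o.
  rewrite mxE; under eq_bigr do rewrite mxE mulrDr mulrBr.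
  rewrite !big_split /= sumrN; congr (_ - _ + _).
  - rewrite (bigD1 (enum_rank x)) //= eqxx mulr1 big1 ?addr0 // => i /negbTE ->.
    by rewrite mulr0.
  - rewrite /markov /avg mulr_suml.
    rewrite (eq_bigr (fun i => \sum_(c | step x c == enum_val i)
       (h (step x c) / #|C|%:R))); last first.
      move=> i _; rewrite enum_rankK mulrA (eq_bigr (fun=> u ord0 i / #|C|%:R)).
        by rewrite sumr_const cardsE -[RHS]mulr_natr mulrAC.
      by move=> c /eqP sc; rewrite /h sc enum_valK.
    rewrite (exchange_big_dep xpredT) //=; apply: eq_bigr => c _.
    rewrite (big_pred1 (enum_rank (step x c))) // => i /=.
    by rewrite -(inj_eq enum_rank_inj) enum_valK eq_sym.
  - rewrite (bigD1 (enum_rank o)) //= enum_rankK eqxx mulr1 big1 ?addr0 //.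
    move=> i io; rewrite -(inj_eq enum_rank_inj) enum_valK (negbTE io).
    by rewrite mulr0.
have Qunit : Q \in unitmx.
  rewrite -row_free_unit -kermx_eq0; apply/eqP/row_matrixP => i; rewrite row0.
  have : row i (kermx Q) *m Q = 0.
    by apply/sub_kermxP; exact: row_sub.
  move: (row i (kermx Q)) => {i} u uQ.
  pose h x := u ord0 (enum_rank x).
  have hE x : h x = markov h x - h o.
    have := QE u x; rewrite uQ mxE -/h => /eqP.
    by rewrite eq_sym addrAC subr_eq0 => /eqP <-; rewrite addrK.
  (* If [h o] were positive, [h] would be subharmonic, hence maximal at [o], and [hE] at [o] would
     give [h o <= 0]. A negative value is excluded in the same way with [- h]. *)
  have ho : h o = 0.
    apply/eqP; rewrite eq_le; apply/andP; split; rewrite leNgt; apply/negP => ho.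
      have hm : forall x, h x <= h o.
        by apply: harmonic_le => x; rewrite hE gerBl ltW.
      have : markov h o <= h o.
        by rewrite -[leRHS](avg_cst C_gt0); apply: le_avg.
      have := hE o; lra.
    have hm : forall x, - h x <= - h o.
      apply: (@harmonic_le (fun x => - h x)) => x.
      by rewrite /markov avgN lerN2 hE -/(markov h x); lra.
    have : h o <= markov h o.
      rewrite -[leLHS](avg_cst C_gt0); apply: le_avg => c.
      by have := hm (step o c); rewrite lerN2.
    have := hE o; lra.
  apply/rowP => j; rewrite mxE -(enum_valK j) -/(h _).
  apply/eqP; rewrite eq_le; apply/andP; split.
    by rewrite -ho; apply: harmonic_le => x; rewrite {1}hE ho subr0.
  rewrite -oppr_le0 -[leRHS]oppr0 -ho.
  apply: (@harmonic_le (fun x => - h x)) => x.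
  by rewrite /markov avgN {1}hE ho subr0.
have [u uE] := rv g.
have QK : u *m invmx Q *m Q = u by rewrite mulmxKV.
(* The constant [gbar] is the value at [o] of the preimage of [g]. *)
exists ((u *m invmx Q) ord0 (enum_rank o)),
  (fun x => (u *m invmx Q) ord0 (enum_rank x)) => x.
by rewrite -uE -[u in LHS]QK QE; lra.
Qed.

End Chain.
(** * Taylor estimates *)

Section Calculus.
Variable R : realType.
Implicit Types (f g df : R -> R) (x y z a b M : R).

Notation D f x a := (is_derive x (1 : R) (f : R -> R) a).

Lemma der_eq f x a b : D f x a -> a = b -> D f x b.
Proof. by move=> + <-. Qed.

Lemma der_cst a x : D (fun=> a) x 0.
Proof. exact: is_derive_cst. Qed.

Lemma der_id x : D (fun y => y) x 1.
Proof. exact: is_derive_id. Qed.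

Lemma der_add f g x a b : D f x a -> D g x b -> D (fun y => f y + g y) x (a + b).
Proof. exact: is_deriveD. Qed.

Lemma der_opp f x a : D f x a -> D (fun y => - f y) x (- a).
Proof. exact: is_deriveN. Qed.

Lemma der_mul f g x a b :
  D f x a -> D g x b -> D (fun y => f y * g y) x (f x * b + g x * a).
Proof. exact: is_deriveM. Qed.

Lemma der_sqr f x a : D f x a -> D (fun y => f y ^+ 2) x (2 * f x * a).
Proof.
by move=> fa; apply: der_eq (der_mul fa fa) _; rewrite mulr2n mulrDl mul1r mulrDl.
Qed.

Lemma der_inv f x a : f x != 0 -> D f x a -> D (fun y => (f y)^-1) x (- a / f x ^+ 2).
Proof.
by move=> fx fa; apply: der_eq (is_deriveV fx fa) _; rewrite /GRing.scale /= mulrC mulrN mulNr.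
Qed.

Lemma der_comp f g x a b : D f (g x) a -> D g x b -> D (fun y => f (g y)) x (a * b).
Proof. exact: is_derive1_comp. Qed.

Lemma increment_le f df a b M : a <= b ->
  (forall x, a <= x <= b -> D f x (df x)) ->
  (forall x, a <= x <= b -> `|df x| <= M) -> `|f b - f a| <= M * (b - a).
Proof.
move=> ab fd dM.
have [||c cab ->] := @MVT_segment R f df a b ab.
- by move=> x; rewrite in_itv /= => /andP[ax xb]; apply: fd; rewrite !ltW.
- apply: derivable_within_continuous => x; rewrite in_itv /= => xab.
  by have [] := fd _ xab.
- rewrite normrM (ger0_norm (x := b - a)) ?subr_ge0 // ler_wpM2r ?subr_ge0 //.
  by apply: dM; move: cab; rewrite in_itv.
Qed.

Lemma increment_norm_le f df x y M :
  (forall z, D f z (df z)) ->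
  (forall z, `|z - x| <= `|y - x| -> `|df z| <= M) ->
  `|f y - f x| <= M * `|y - x|.
Proof.
move=> fd dM; case: (leP x y) => xy.
  rewrite [`|y - x|]ger0_norm ?subr_ge0 //; apply: (increment_le (df := df)) => //.
  move=> z /andP[xz zy]; apply: dM; rewrite !ger0_norm ?subr_ge0 //.
  by rewrite lerB.
have yx := ltW xy.
rewrite distrC [`|y - x|]distrC [`|x - y|]ger0_norm ?subr_ge0 //.
apply: (increment_le (df := df)) => //.
move=> z /andP[yz zx]; apply: dM; rewrite distrC [`|y - x|]distrC.
by rewrite !ger0_norm ?subr_ge0 // lerB.
Qed.

Section Taylor.
Variables (u u1 u2 u3 : R -> R) (x e M : R).
Hypotheses (ud : forall z, D u z (u1 z)) (u1d : forall z, D u1 z (u2 z))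
  (u2d : forall z, D u2 z (u3 z)).
Hypothesis u3M : forall z, `|z - x| <= e -> `|u3 z| <= M.

Lemma taylor_order0 y : `|y - x| <= e -> `|u2 y - u2 x| <= M * `|y - x|.
Proof.
move=> he; apply: increment_norm_le u2d _ => z zh; apply: u3M.
exact: le_trans zh he.
Qed.

(** The derivative of the remainder is the remainder of the previous order, so the mean value
    inequality raises the order by one. The factorials of the sharp constants are dropped. *)
Lemma taylor_order1 y : `|y - x| <= e ->
  `|u1 y - u1 x - (y - x) * u2 x| <= M * `|y - x| ^+ 2.
Proof.
move=> he; pose f z := u1 z - (z - x) * u2 x.
have fd z : D f z (u2 z - u2 x).
  apply: der_eq (der_add (u1d z) (der_opp (der_mul (der_add (der_id z)
    (der_cst (- x) z)) (der_cst (u2 x) z)))) _.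
  by rewrite mulr0 add0r addr0 mulr1.
have -> : u1 y - u1 x - (y - x) * u2 x = f y - f x.
  by rewrite /f subrr mul0r subr0 addrAC.
rewrite expr2 mulrA; apply: increment_norm_le fd _ => z zh.
have ze := le_trans zh he.
apply: le_trans (taylor_order0 ze) _; apply: ler_wpM2l => //.
by apply: le_trans (u3M ze).
Qed.

Lemma taylor_order2 y : `|y - x| <= e ->
  `|u y - u x - (y - x) * u1 x - (y - x) ^+ 2 / 2 * u2 x| <= M * `|y - x| ^+ 3.
Proof.
move=> he; pose f z := u z - (z - x) * u1 x - (z - x) ^+ 2 / 2 * u2 x.
have fd z : D f z (u1 z - u1 x - (z - x) * u2 x).
  have dx := der_add (der_id z) (der_cst (- x) z).
  apply: der_eq (der_add (der_add (ud z) (der_opp (der_mul dx (der_cst (u1 x) z))))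
    (der_opp (der_mul (der_mul (der_sqr dx) (der_cst 2^-1 z)) (der_cst (u2 x) z)))) _.
  by field.
have -> : u y - u x - (y - x) * u1 x - (y - x) ^+ 2 / 2 * u2 x = f y - f x.
  by rewrite /f; ring.
rewrite exprSr mulrA; apply: increment_norm_le fd _ => z zh.
have ze := le_trans zh he.
apply: le_trans (taylor_order1 ze) _; apply: ler_wpM2l.
  by apply: le_trans (u3M ze).
by rewrite ler_sqr ?nnegrE.
Qed.
End Taylor.
End Calculus.

(** * The heat equation *)

Section Gauss.
Variable R : realType.
Implicit Types x y s t : R.

(** The normal distribution function [F] is made odd by taking [F x - F (- x)], and divided by twice
    the peak of the density. *)
Lemma primitive_gauss : exists E : R -> R,
  (forall x, is_derive x 1 E (expR (- x ^+ 2 / 2))) /\ (forall x, E (- x) = - E x).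
Proof.
pose f := normal_pdf (0 : R) 1.
pose F x : R := (\int[lebesgue_measure]_(t in [set` `]-oo, x]]) f t)%R.
have dF x : is_derive x 1 F (f x).
  have [||||dFx Fx] := @continuous_FTC1 R f -oo%O x (x + 1).
  - by rewrite ltrDl.
  - apply: (@integrableS _ _ _ _ setT) => //.
    exact: integrable_normal_pdf.
  - by rewrite ltNyr.
  - exact: continuous_normal_pdf.
  by rewrite -Fx derive1E; apply: DeriveDef.
have fE x : f x = normal_peak 1 * expR (- x ^+ 2 / 2).
  by rewrite /f normal_pdfE ?oner_neq0 // /normal_fun subr0 expr1n mulr2n.
have p0 : normal_peak (1 : R) != 0 by rewrite gt_eqF // normal_peak_gt0 ?oner_neq0.
exists (fun x => (F x - F (- x)) / (2 * normal_peak 1)); split => x; last first.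
  by rewrite opprK -mulNr opprB.
have dFN : is_derive x 1 (fun y => F (- y)) (f (- x) * (- 1)).
  exact: (@is_derive1_comp R F -%R x).
have -> : expR (- x ^+ 2 / 2) = (2 * normal_peak 1)^-1 *: (f x - f (- x) * -1).
  rewrite !fE sqrrN /GRing.scale /=; field; exact: p0.
under eq_fun do rewrite mulrC.
apply: is_deriveZ.
Qed.

Notation D f x a := (is_derive x (1 : R) (f : R -> R) a).

Definition gauss x : R := expR (- x ^+ 2 / 2).

Lemma gauss_gt0 x : 0 < gauss x. Proof. exact: expR_gt0. Qed.

Lemma gauss_ge0 x : 0 <= gauss x. Proof. exact: expR_ge0. Qed.

(** This is [1 + y ^+ 2 / 2 <= expR y] at [y = x ^+ 2 / 2]. Through [gauss_le_poly], the bounds on a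
    Gaussian times a polynomial of degree below 4 follow from it. *)
Lemma gauss_le x : gauss x * (1 + x ^+ 4 / 8) <= 1.
Proof.
rewrite -ler_pdivlMl ?gauss_gt0 // mulr1 /gauss mulNr expRN invrK.
have := @expR_ge1Dxn R (x ^+ 2 / 2) 1; rewrite divr_ge0 ?sqr_ge0 // => /(_ isT).
apply: le_trans; rewrite lerD2l (_ : x ^+ 4 / 8 = (x ^+ 2 / 2) ^+ 2 / 2`!%:R) //.
by rewrite (_ : 2`!%:R = 2) //; field.
Qed.

Lemma gauss_le1 x : gauss x <= 1.
Proof. by rewrite /gauss -[leRHS]expR0 ler_expR mulNr oppr_le0 divr_ge0 ?sqr_ge0. Qed.

Lemma gauss_le_poly x (p C : R) :
  0 <= C -> p <= C * (1 + x ^+ 4 / 8) -> gauss x * p <= C.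
Proof.
move=> C0 pC; apply: (@le_trans _ _ (gauss x * (C * (1 + x ^+ 4 / 8)))).
  by rewrite ler_wpM2l ?gauss_ge0.
by rewrite mulrCA -[leRHS]mulr1 ler_wpM2l ?gauss_le.
Qed.

Lemma gauss_le_quad x : gauss x * x ^+ 2 <= 2.
Proof.
apply: gauss_le_poly => //.
have -> : x ^+ 4 = (x ^+ 2) ^+ 2 by rewrite -exprM.
have := sqr_ge0 (x ^+ 2 - 2); lra.
Qed.

Lemma gauss_le_cube x : 0 <= x -> gauss x * x ^+ 3 <= 8.
Proof.
move=> x0; apply: gauss_le_poly => //.
have [x1|x1] := leP x 1.
  have : x ^+ 3 <= 1 by rewrite exprn_ile1.
  have : 0 <= x ^+ 4 by rewrite exprn_ge0.
  lra.
have : x ^+ 3 <= x ^+ 4 by rewrite ler_eXn2l.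
lra.
Qed.

Lemma gauss_le_deriv3 x : gauss x * (`|x| * (3 + x ^+ 2)) <= 16.
Proof.
apply: gauss_le_poly => //.
rewrite -[x ^+ 2]real_normK ?num_real // (_ : x ^+ 4 = `|x| ^+ 4); last first.
  by rewrite -[4%N]/(2 * 2)%N !exprM real_normK ?num_real.
move: (normr_ge0 x); move: (`|x|) => y y0.
have [y1|y1] := leP y 1.
  have : y ^+ 2 <= 1 by rewrite exprn_ile1.
  have : 0 <= y ^+ 4 by rewrite exprn_ge0.
  move=> a b; nra.
have : y ^+ 3 <= y ^+ 4 by rewrite ler_eXn2l.
have := sqr_ge0 (y - 1); have := sqr_ge0 (y ^+ 2 - 1).
have -> : y * (3 + y ^+ 2) = 3 * y + y ^+ 3 by ring.
lra.
Qed.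

Lemma der_gauss x : D gauss x (- x * gauss x).
Proof.
have dq := der_mul (der_opp (der_sqr (der_id x))) (der_cst (2^-1) x).
by apply: der_eq (der_comp (is_derive_expR _) dq) _; rewrite /gauss; field.
Qed.

Section HeatSolution.
Variable E : R -> R.
Hypotheses (dE : forall x, D E x (gauss x)) (EN : forall x, E (- x) = - E x).

Let E0 : E 0 = 0.
Proof. by have := EN 0; rewrite oppr0; lra. Qed.

Lemma mvt_E a b : a <= b -> exists2 c, a <= c <= b & E b - E a = gauss c * (b - a).
Proof.
move=> ab; have [|c + ->] := @MVT_segment R E gauss a b ab.
  by apply: derivable_within_continuous => y _; have [] := dE y.
by rewrite in_itv => cab; exists c.
Qed.

Lemma E_mono a b : a <= b -> E a <= E b.
Proof.
move=> ab; rewrite -subr_ge0; have [c _ ->] := mvt_E ab.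
by rewrite mulr_ge0 ?gauss_ge0 ?subr_ge0.
Qed.

(** The function [E x + 4 / x ^+ 2] is nonincreasing on the positive axis, by [gauss_le_cube]. *)
Lemma E_increment a b : 0 < a -> a <= b -> E b - E a <= 4 / a ^+ 2.
Proof.
move=> a0 ab; have b0 : 0 < b by apply: lt_le_trans ab.
pose f x := E x + 4 * (x ^+ 2)^-1.
have dh x : a <= x -> D f x (gauss x - 8 / x ^+ 3).
  move=> ax; have x0 : x != 0 by rewrite gt_eqF // (lt_le_trans a0).
  have x2 : x ^+ 2 != 0 by rewrite expf_neq0.
  apply: der_eq (der_add (dE x) (der_mul (der_cst 4 x)
     (der_inv (f := fun y => y ^+ 2) x2 (der_sqr (der_id x))))) _.
  by field.
have [x||c] := @MVT_segment R f (fun x => gauss x - 8 / x ^+ 3) a b ab.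
  - by rewrite in_itv => /andP[ax _]; apply: dh; apply: ltW.
  - by apply: derivable_within_continuous => x; rewrite in_itv => /andP[/dh[]].
rewrite in_itv /= => /andP[ac _] h.
suff : E b - E a <= 4 / a ^+ 2 - 4 / b ^+ 2.
  by move=> /le_trans; apply; rewrite gerBl divr_ge0 ?sqr_ge0.
suff : (gauss c - 8 / c ^+ 3) * (b - a) <= 0 by move: h; rewrite /f; lra.
have c0 : 0 < c by apply: lt_le_trans ac.
rewrite mulr_le0_ge0 ?subr_ge0 // subr_le0 ler_pdivlMr ?exprn_gt0 //.
by rewrite gauss_le_cube // ltW.
Qed.

(** The limit is taken as the supremum of the increasing function [E] over [x >= 1]; [E_increment]
    gives the rate. *)
Lemma E_limit : exists kappa, 0 < kappa /\
  forall x, 0 < x -> 0 <= kappa - E x <= 4 / x ^+ 2.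
Proof.
pose S := [set E x | x in [set x | 1 <= x]]%classic.
have S1 : has_sup S.
  split; first by exists (E 1); exists 1 => //=.
  exists (E 1 + 4) => _ [x /= x1 <-].
  by have := E_increment ltr01 x1; rewrite expr1n divr1; lra.
have E1 : 0 < E 1.
  have [c _] := mvt_E ler01.
  by rewrite E0 !subr0 => ->; rewrite mulr1 gauss_gt0.
have supE x : 0 < x -> E x <= sup S.
  move=> x0; apply: (@le_trans _ _ (E (Num.max x 1))).
    by apply: E_mono; rewrite le_max lexx.
  apply: ub_le_sup; first by have [] := S1.
  by exists (Num.max x 1) => //=; rewrite le_max lexx orbT.
exists (sup S); split; first by apply: lt_le_trans (supE 1 _).
move=> x x0; rewrite subr_ge0 supE //= lerBlDl.
apply: ge_sup; first by have [] := S1.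
move=> _ [y /= y1 <-].
have [xy|yx] := leP x y.
  by rewrite -lerBlDl E_increment.
apply: (le_trans (E_mono (ltW yx))); rewrite lerDl.
by rewrite divr_ge0 ?sqr_ge0.
Qed.

(* The solution of [V_t = V_xx / 2] at time [s ^+ 2] with initial value [kappa * `|x|], where
   [kappa] is the limit of [E] at infinity; [heat2] and [heat3] are its derivatives in [x]. *)
Definition heat s x : R := x * E (x / s) + s * gauss (x / s).
Definition heat2 s x : R := gauss (x / s) / s.
Definition heat3 s x : R := - (x / s) * gauss (x / s) / s ^+ 2.

Lemma der_div s x : D (fun y => y / s) x s^-1.
Proof.
by apply: der_eq (der_mul (der_id x) (der_cst s^-1 x)) _; rewrite mulr0 add0r mulr1.
Qed.

Lemma der_heat s x : s != 0 -> D (heat s) x (E (x / s)).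
Proof.
move=> s0; have dxs := der_div s x.
apply: der_eq (der_add (der_mul (der_id x) (der_comp (dE _) dxs))
  (der_mul (der_cst s x) (der_comp (der_gauss _) dxs))) _.
by field.
Qed.

Lemma der_heat1 s x : s != 0 -> D (fun y => E (y / s)) x (heat2 s x).
Proof. by move=> s0; apply: der_comp (dE _) (der_div s x). Qed.

Lemma der_heat2 s x : s != 0 -> D (heat2 s) x (heat3 s x).
Proof.
move=> s0; apply: der_eq (der_mul (der_comp (der_gauss _) (der_div s x))
  (der_cst s^-1 x)) _.
by rewrite /heat3; field.
Qed.

(** In the variable [x / s] this is [gauss_le_deriv3]. The denominator is the one that appears in
    the gain of the corrector, see [corr_time]. *)
Lemma heat3_le s x : 0 < s -> `|heat3 s x| <= 16 / (3 * s ^+ 2 + x ^+ 2).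
Proof.
move=> s0; have q0 : 0 < 3 * s ^+ 2 + x ^+ 2.
  by rewrite ltr_pwDl ?sqr_ge0 // mulr_gt0 ?exprn_gt0.
rewrite ler_pdivlMr // /heat3 !normrM normrN ger0_norm ?gauss_ge0 //.
rewrite [`|(s ^+ 2)^-1|]ger0_norm ?invr_ge0 ?sqr_ge0 //.
apply: le_trans (gauss_le_deriv3 (x / s)).
rewrite le_eqVlt; apply/orP; left; apply/eqP.
move: (`|x / s|) => a; field; exact: lt0r_neq0.
Qed.

(** Taylor remainders are evaluated near [x], while the barrier is evaluated at [x]. Here
    [x ^+ 2 <= 2 * z ^+ 2 + 2 * e ^+ 2], and [1 <= s] absorbs the last term. *)
Lemma shift_le s x z e : 1 <= s -> `|z - x| <= e ->
  (3 * s ^+ 2 + z ^+ 2)^-1 <= (2 + e ^+ 2) / (3 * s ^+ 2 + x ^+ 2).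
Proof.
move=> s1 zx; have e0 : 0 <= e by apply: le_trans zx.
have s2 : 1 <= s ^+ 2 by rewrite exprn_ege1.
rewrite ler_pdivlMr; last by rewrite ltr_pwDl ?sqr_ge0 //; lra.
rewrite mulrC ler_pdivrMr; last by rewrite ltr_pwDl ?sqr_ge0 //; lra.
have ze : (z - x) ^+ 2 <= e ^+ 2 by rewrite -[leLHS]real_normK ?num_real // ler_sqr ?nnegrE.
have e2 := sqr_ge0 e; have z2 := sqr_ge0 z; have h := sqr_ge0 (x - 2 * z).
nra.
Qed.

Lemma heat3_near s x z e : 1 <= s -> `|z - x| <= e ->
  `|heat3 s z| <= 16 * (2 + e ^+ 2) / (3 * s ^+ 2 + x ^+ 2).
Proof.
move=> s1 zx; apply: le_trans (heat3_le _ _) _; first by apply: lt_le_trans s1.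
by rewrite -mulrA ler_wpM2l // shift_le.
Qed.

Lemma heat_even s x : heat s (- x) = heat s x.
Proof. by rewrite /heat !mulNr EN mulrN opprK /gauss sqrrN. Qed.

Lemma heat_norm s x : heat s x = heat s `|x|.
Proof.
by case: (ger0P x) => _ //; rewrite heat_even.
Qed.

Lemma heat0 s : heat s 0 = s.
Proof. by rewrite /heat !mul0r add0r /gauss expr0n /= oppr0 mul0r expR0 mulr1. Qed.

Section Limit.
Variable kappa : R.
Hypothesis E_lim : forall x, 0 < x -> 0 <= kappa - E x <= 4 / x ^+ 2.

(** For a nonzero drift, [s ^+ 2] and [x] are both of the order of the time, and the error is
    bounded: no square root term arises. *)
Lemma heat_far s x : 0 < s -> x != 0 -> `|kappa * `|x| - heat s x| <= 6 * s ^+ 2 / `|x|.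
Proof.
move=> s0; rewrite -normr_gt0 heat_norm; move: (`|x|) => y y0.
have ys : 0 < y / s by rewrite divr_gt0.
have /andP[k0 k1] := E_lim ys.
have g1 : gauss (y / s) * (y / s) <= 2.
  apply: gauss_le_poly => //; move: (y / s) => w.
  have := sqr_ge0 (w ^+ 2 - 2); have := sqr_ge0 (w - 1).
  by have := sqr_ge0 (w ^+ 2); lra.
have h1 : y * (kappa - E (y / s)) <= 4 * s ^+ 2 / y.
  have -> : 4 * s ^+ 2 / y = y * (4 / (y / s) ^+ 2) by field; rewrite !lt0r_neq0.
  exact: ler_wpM2l (ltW y0) _ _ k1.
have h2 : s * gauss (y / s) <= 2 * s ^+ 2 / y.
  have -> : s * gauss (y / s) = (gauss (y / s) * (y / s)) * (s ^+ 2 / y).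
    by field; rewrite !lt0r_neq0.
  rewrite -[leRHS]mulrA; apply: ler_wpM2r g1.
  by rewrite divr_ge0 ?sqr_ge0 ?ltW.
have h3 := mulr_ge0 (ltW y0) k0; have h4 := mulr_ge0 (ltW s0) (gauss_ge0 (y / s)).
rewrite ler_norml /heat; apply/andP; split; lra.
Qed.

Lemma heat_near s x : 0 < kappa -> 0 < s -> `|kappa * `|x| - heat s x| <= (kappa + 6) * s.
Proof.
move=> k0 s0; have [sx|xs] := leP s `|x|.
  have x0 : 0 < `|x| by apply: lt_le_trans sx.
  apply: le_trans (heat_far s0 _) _; first by rewrite -normr_gt0.
  rewrite ler_pdivrMr //.
  have := mulr_gt0 k0 s0; have := ler_wpM2l (ltW s0) sx; have := ltW s0; nra.
rewrite heat_norm; move: (normr_ge0 x) xs; move: (`|x|) => y y0 ys.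
have e0 : 0 <= E (y / s) by rewrite -E0 E_mono // divr_ge0 // ltW.
have e1 : E (y / s) <= kappa.
  apply: (@le_trans _ _ (E 1)); first by rewrite E_mono // ler_pdivrMr // mul1r ltW.
  by have /andP[+ _] := E_lim ltr01; rewrite subr_ge0.
have g0 := gauss_ge0 (y / s); have g1 := gauss_le1 (y / s).
rewrite /heat; have h1 : y * E (y / s) <= s * kappa by rewrite ler_pM // ltW.
have h2 := mulr_ge0 y0 e0; have h3 : s * gauss (y / s) <= s * 1 by rewrite ler_wpM2l // ltW.
have h4 := mulr_ge0 (ltW s0) g0; have h5 : kappa * y <= kappa * s by rewrite ler_wpM2l // ltW.
have h6 := mulr_ge0 (ltW k0) y0.
rewrite ler_norml; apply/andP; split; lra.
Qed.
End Limit.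

Section TimeStep.
Variables s s' : R.
Hypotheses (s1 : 1 <= s) (ss : 0 <= s') (s's : s' ^+ 2 = s ^+ 2 + 1).

Let s0 : 0 < s. Proof. by apply: lt_le_trans s1. Qed.
Let lt_ss' : s < s'.
Proof. by rewrite -(ltr_sqr _ ss) ?nnegrE ?(ltW s0) //= s's ltrDl. Qed.
Let s'0 : 0 < s'. Proof. by apply: lt_trans lt_ss'. Qed.
Let eE : (s' - s) * (s' + s) = 1.
Proof. by rewrite -subr_sqr s's; ring. Qed.
Let e_le : (s' - s) * (2 * s) <= 1.
Proof.
rewrite -[leRHS]eE; apply: ler_wpM2l; first by rewrite subr_ge0 ltW.
have := ltW lt_ss'; lra.
Qed.

Lemma gauss_time r x : s <= r -> `|gauss (x / r) - gauss (x / s)| <= 2 / s * (r - s).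
Proof.
move=> sr; pose dg y := gauss (x / y) * (x / y) ^+ 2 / y.
apply: (increment_le (f := fun y => gauss (x / y)) (df := dg)) => // y /andP[sy _].
  have y0 : y != 0 by rewrite gt_eqF // (lt_le_trans s0).
  apply: der_eq (der_comp (der_gauss _) (der_mul (der_cst x y) (der_inv y0 (der_id y)))) _.
  by rewrite /dg; field.
have y0 : 0 < y by apply: lt_le_trans sy.
have gy0 : 0 <= gauss (x / y) * (x / y) ^+ 2 by rewrite mulr_ge0 ?gauss_ge0 ?sqr_ge0.
have iy0 : 0 <= y^-1 by rewrite invr_ge0 ltW.
rewrite /dg ger0_norm; last exact: mulr_ge0.
by apply: ler_pM => //; rewrite ?gauss_le_quad // lef_pV2 ?posrE.
Qed.

(** The derivative of [heat] in [s] is [gauss (x / s)], that is [s * heat2 s x], and [s' - s] is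
    close to [1 / (2 * s)]. The error comes from the variation of the Gaussian over the step ([h1])
    and from the defect of [s' - s] ([h2]). *)
Lemma heat_time x : `|heat s' x - heat s x - heat2 s x / 2| <= 1 / s ^+ 3.
Proof.
have h1 : `|(heat s' x - s' * gauss (x / s)) - (heat s x - s * gauss (x / s))|
    <= 2 / s * (s' - s) * (s' - s).
  apply: (increment_le (f := fun r => heat r x - r * gauss (x / s))
     (df := fun r => gauss (x / r) - gauss (x / s))); first exact: ltW.
    move=> r /andP[sr _]; have r0 : r != 0 by rewrite gt_eqF // (lt_le_trans s0).
    have dxr := der_mul (der_cst x r) (der_inv r0 (der_id r)).
    apply: der_eq (der_add (der_add (der_mul (der_cst x r) (der_comp (dE _) dxr))
      (der_mul (der_id r) (der_comp (der_gauss _) dxr)))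
      (der_opp (der_mul (der_id r) (der_cst (gauss (x / s)) r)))) _.
    by field.
  move=> r /andP[sr rs]; apply: le_trans (gauss_time x sr) _.
  by rewrite ler_wpM2l ?divr_ge0 ?(ltW s0) // lerD2r.
have h2 : `|(s' - s) - (2 * s)^-1| <= (s' - s) ^+ 2 / (2 * s).
  have -> : (s' - s) - (2 * s)^-1 = - ((s' - s) ^+ 2 / (2 * s)).
    have : (s' - s) * (2 * s) + (s' - s) ^+ 2 = 1 by rewrite -[RHS]eE; ring.
    move=> h; rewrite -[(2 * s)^-1]mul1r -[X in _ - X / _]h.
    by field; exact: lt0r_neq0.
  by rewrite normrN ger0_norm // divr_ge0 ?sqr_ge0 // mulr_ge0 // ltW.
have -> : heat s' x - heat s x - heat2 s x / 2 =
  ((heat s' x - s' * gauss (x / s)) - (heat s x - s * gauss (x / s))) +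
  gauss (x / s) * ((s' - s) - (2 * s)^-1).
  by rewrite /heat2; field; exact: lt0r_neq0.
apply: le_trans (ler_normD _ _) _; rewrite normrM [`|gauss _|]ger0_norm ?gauss_ge0 //.
have h3 : gauss (x / s) * `|s' - s - (2 * s)^-1| <= (s' - s) ^+ 2 / (2 * s).
  by rewrite -[leRHS]mul1r ler_pM ?gauss_ge0 ?gauss_le1.
apply: le_trans (lerD h1 h3) _.
have e0 : 0 <= s' - s by rewrite subr_ge0 ltW.
have : (s' - s) ^+ 2 * (4 * s ^+ 2) <= 1.
  rewrite (_ : _ * _ = ((s' - s) * (2 * s)) ^+ 2); last by ring.
  by rewrite exprn_ile1 // mulr_ge0 // mulr_ge0 // ltW.
rewrite ler_pdivlMr ?exprn_gt0 //.
have -> : (2 / s * (s' - s) * (s' - s) + (s' - s) ^+ 2 / (2 * s)) * s ^+ 3 =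
  5 / 8 * ((s' - s) ^+ 2 * (4 * s ^+ 2)) by field; exact: lt0r_neq0.
lra.
Qed.

(** This is the gain of the barrier [t^(-1/2)]: in one unit of time it decreases by enough to absorb
    errors of order [t^(-3/2)]. *)
Lemma inv_time : 1 / (6 * s ^+ 3) <= s^-1 - s'^-1.
Proof.
have s's2 : s' <= 2 * s.
  rewrite -(ler_sqr ss) ?nnegrE ?mulr_ge0 ?(ltW s0) //= s's exprMn.
  have : 1 <= s ^+ 2 by rewrite exprn_ege1.
  lra.
have -> : s^-1 - s'^-1 = (s' - s) * (s' + s) / ((s' + s) * s * s').
  by field; rewrite !lt0r_neq0 // addr_gt0.
have sp : 0 < s' + s by rewrite addr_gt0.
rewrite eE !div1r lef_pV2 ?posrE ?mulr_gt0 ?exprn_gt0 //.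
have -> : 6 * s ^+ 3 = (2 * s + s) * s * (2 * s) by ring.
apply: ler_pM => //; first by rewrite mulr_ge0 // ltW.
by rewrite ler_pM2r // lerD2r.
Qed.

Lemma heat2_time x : `|heat2 s' x - heat2 s x| <= 2 / s ^+ 3.
Proof.
have -> : heat2 s' x - heat2 s x = (gauss (x / s') - gauss (x / s)) / s'
   - gauss (x / s) * (s^-1 - s'^-1).
  by rewrite /heat2; field; rewrite !lt0r_neq0.
apply: le_trans (ler_normB _ _) _; rewrite !normrM [`|gauss _|]ger0_norm ?gauss_ge0 //.
have e0 : 0 <= s' - s by rewrite subr_ge0 ltW.
have iE : s^-1 - s'^-1 = (s' - s) / (s * s') by field; rewrite !lt0r_neq0.
have i0 : 0 <= s^-1 - s'^-1 by rewrite iE divr_ge0 // mulr_ge0 // ltW.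
have i1 : s'^-1 <= s^-1 by rewrite lef_pV2 ?posrE // ltW.
rewrite [`|s'^-1|]ger0_norm ?invr_ge0 ?(ltW s'0) // [`|_ - _^-1|]ger0_norm //.
have e1 : s' - s <= (2 * s)^-1 by rewrite -[leRHS]mul1r ler_pdivlMr // mulr_gt0.
have h1 : `|gauss (x / s') - gauss (x / s)| / s' <= 2 / s * (2 * s)^-1 / s.
  apply: ler_pM => //; first by rewrite invr_ge0 ltW.
  apply: le_trans (gauss_time x (ltW lt_ss')) _.
  by rewrite ler_wpM2l ?divr_ge0 // ltW.
have h2 : gauss (x / s) * (s^-1 - s'^-1) <= 1 * ((2 * s)^-1 / (s * s)).
  rewrite iE; apply: ler_pM;
    rewrite ?gauss_ge0 ?gauss_le1 ?divr_ge0 ?mulr_ge0 ?(ltW s0) ?(ltW s'0) //.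
  apply: ler_pM => //; first by rewrite invr_ge0 mulr_ge0 // ltW.
  by rewrite lef_pV2 ?posrE ?mulr_gt0 // ler_wpM2l // ltW.
apply: le_trans (lerD h1 h2) _.
have -> : 2 / s * (2 * s)^-1 / s + 1 * ((2 * s)^-1 / (s * s)) = (3 / 2) / s ^+ 3.
  by field; exact: lt0r_neq0.
by rewrite ler_wpM2r ?invr_ge0 ?exprn_ge0 ?ltW //; lra.
Qed.

End TimeStep.
End HeatSolution.
End Gauss.

(** * A bounded space-time barrier for the errors in the heat equation *)

Section Corrector.
Variable R : realType.
Implicit Types x y z s t : R.

Notation D f x a := (is_derive x (1 : R) (f : R -> R) a).

(* With [t = s ^+ 2], this is [B = t / (3 * t + x ^+ 2)], for which [B_t - B_xx / 2] is
   [(x ^+ 4 + 3 * t ^+ 2) / (3 * t + x ^+ 2) ^+ 3]; the constant 3 makes this at least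
   [1 / (4 * (3 * t + x ^+ 2))]. *)
Definition corr s x : R := s ^+ 2 / (3 * s ^+ 2 + x ^+ 2).
Definition corr1 s x : R := - (2 * x * s ^+ 2) / (3 * s ^+ 2 + x ^+ 2) ^+ 2.
Definition corr2 s x : R := 6 * s ^+ 2 * (x ^+ 2 - s ^+ 2) / (3 * s ^+ 2 + x ^+ 2) ^+ 3.
Definition corr3 s x : R :=
  24 * s ^+ 2 * x * (3 * s ^+ 2 - x ^+ 2) / (3 * s ^+ 2 + x ^+ 2) ^+ 4.

Lemma corr_den_gt0 s x : 0 < s -> 0 < 3 * s ^+ 2 + x ^+ 2.
Proof. by move=> s0; rewrite ltr_pwDl ?sqr_ge0 // mulr_gt0 ?exprn_gt0. Qed.

Lemma der_den s x : D (fun y => 3 * s ^+ 2 + y ^+ 2) x (2 * x).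
Proof.
apply: der_eq (der_add (der_cst (3 * s ^+ 2) x) (der_sqr (der_id x))) _.
by rewrite add0r mulr1.
Qed.

Lemma der_corr s x : 0 < s -> D (corr s) x (corr1 s x).
Proof.
move=> s0; have q0 := lt0r_neq0 (corr_den_gt0 x s0).
apply: der_eq (der_mul (der_cst (s ^+ 2) x)
  (der_inv (f := fun y => 3 * s ^+ 2 + y ^+ 2) q0 (der_den s x))) _.
by rewrite /corr1; field.
Qed.

Lemma der_corr1 s x : 0 < s -> D (corr1 s) x (corr2 s x).
Proof.
move=> s0; have q0 := lt0r_neq0 (corr_den_gt0 x s0).
have q2 : (3 * s ^+ 2 + x ^+ 2) ^+ 2 != 0 by rewrite expf_neq0.
apply: der_eq (der_mul (der_opp (der_mul (der_mul (der_cst 2 x) (der_id x)) (der_cst (s ^+ 2) x)))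
  (der_inv (f := fun y => (3 * s ^+ 2 + y ^+ 2) ^+ 2) q2 (der_sqr (der_den s x)))) _.
by rewrite /corr2; field.
Qed.

Lemma der_corr2 s x : 0 < s -> D (corr2 s) x (corr3 s x).
Proof.
move=> s0; have q0 := lt0r_neq0 (corr_den_gt0 x s0).
have q3 : (3 * s ^+ 2 + x ^+ 2) ^+ 2 * (3 * s ^+ 2 + x ^+ 2) != 0.
  by rewrite mulf_neq0 ?expf_neq0.
have -> : corr2 s = (fun y => 6 * s ^+ 2 * (y ^+ 2 - s ^+ 2) *
    ((3 * s ^+ 2 + y ^+ 2) ^+ 2 * (3 * s ^+ 2 + y ^+ 2))^-1).
  by apply/funext => y; rewrite /corr2 [_ ^+ 3]exprSr.
apply: der_eq (der_mul (der_mul (der_cst (6 * s ^+ 2) x)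
    (der_add (der_sqr (der_id x)) (der_opp (der_cst (s ^+ 2) x))))
  (der_inv (f := fun y => (3 * s ^+ 2 + y ^+ 2) ^+ 2 * (3 * s ^+ 2 + y ^+ 2)) q3
    (der_mul (der_sqr (der_den s x)) (der_den s x)))) _.
by rewrite /corr3; field.
Qed.

Lemma corr_ge0 s x : 0 <= corr s x.
Proof.
apply: divr_ge0; first exact: sqr_ge0.
by apply: addr_ge0; rewrite ?sqr_ge0 // mulr_ge0 ?sqr_ge0.
Qed.

Lemma corr_le1 s x : 0 < s -> corr s x <= 1.
Proof.
move=> s0; rewrite ler_pdivrMr ?corr_den_gt0 // mul1r.
have := sqr_ge0 x; have := sqr_ge0 s; lra.
Qed.

Lemma corr2_le1 s x : 1 <= s -> `|corr2 s x| <= 1.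
Proof.
move=> s1; have s0 : 0 < s by apply: lt_le_trans s1.
have q0 := corr_den_gt0 x s0.
have s2 : 1 <= s ^+ 2 by rewrite exprn_ege1.
rewrite /corr2 normrM [`|_^-1|]ger0_norm ?invr_ge0 ?exprn_ge0 ?(ltW q0) //.
rewrite ler_pdivrMr ?exprn_gt0 // mul1r normrM ger0_norm; last by rewrite mulr_ge0 ?sqr_ge0.
have x2 := sqr_ge0 x.
have h : `|x ^+ 2 - s ^+ 2| <= 3 * s ^+ 2 + x ^+ 2.
  by rewrite ler_norml; apply/andP; split; lra.
rewrite [_ ^+ 3]exprSr; apply: ler_pM => //; first by rewrite mulr_ge0 ?sqr_ge0.
move: s2 x2; set t := s ^+ 2; set z := x ^+ 2; move=> t1 z0; nra.
Qed.

Lemma corr3_le s x : 0 < s -> `|corr3 s x| <= 3 / s ^+ 3.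
Proof.
move=> s0; have q0 := corr_den_gt0 x s0.
rewrite /corr3 normrM [`|_^-1|]ger0_norm ?invr_ge0 ?exprn_ge0 ?(ltW q0) //.
rewrite ler_pdivrMr ?exprn_gt0 // [leRHS]mulrAC ler_pdivlMr ?exprn_gt0 //.
have x2 := sqr_ge0 x; have s2 := sqr_ge0 s.
have h : `|3 * s ^+ 2 - x ^+ 2| <= 3 * s ^+ 2 + x ^+ 2 by rewrite ler_norml; apply/andP; split; lra.
have h2 : `|x| * s <= 3 * s ^+ 2 + x ^+ 2.
  rewrite -[x ^+ 2]real_normK ?num_real //.
  have := sqr_ge0 (`|x| - s); have := sqr_ge0 (`|x|); lra.
have h3 : 8 * s ^+ 4 <= (3 * s ^+ 2 + x ^+ 2) ^+ 2.
  have -> : s ^+ 4 = (s ^+ 2) ^+ 2 by rewrite -exprM.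
  move: x2 s2; set t := s ^+ 2; set z := x ^+ 2; move=> t1 z0; nra.
have c0 : 0 <= 24 * s ^+ 2 by rewrite mulr_ge0.
rewrite -mulrA normrM [`|24 * _|]ger0_norm // normrM.
have -> : 24 * s ^+ 2 * (`|x| * `|3 * s ^+ 2 - x ^+ 2|) * s ^+ 3 =
  3 * ((8 * s ^+ 4) * ((`|x| * s) * `|3 * s ^+ 2 - x ^+ 2|)) by ring.
rewrite ler_wpM2l //.
move: (3 * s ^+ 2 + x ^+ 2) q0 h h2 h3 => q q0 h h2 h3.
have -> : q ^+ 4 = q ^+ 2 * (q * q) by ring.
have xs0 : 0 <= `|x| * s by rewrite mulr_ge0 ?(ltW s0).
rewrite ler_pM //; first by rewrite mulr_ge0 ?exprn_ge0 ?(ltW s0).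
  by rewrite mulr_ge0.
by rewrite ler_pM.
Qed.

Section TimeStep.
Variables s s' : R.
Hypotheses (s1 : 1 <= s) (s's : s' ^+ 2 = s ^+ 2 + 1).

Let s0 : 0 < s. Proof. by apply: lt_le_trans s1. Qed.
Let t1 : 1 <= s ^+ 2. Proof. by rewrite exprn_ege1. Qed.
Let t_inv : (s ^+ 2 * s ^+ 2)^-1 <= (s ^+ 3)^-1.
Proof.
rewrite lef_pV2 ?posrE ?mulr_gt0 ?exprn_gt0 // -exprD.
by rewrite ler_weXn2l.
Qed.

Lemma corr_time x :
  1 / (4 * (3 * s ^+ 2 + x ^+ 2)) - 1 / s ^+ 3 <= corr s' x - corr s x - corr2 s x / 2.
Proof.
rewrite /corr /corr2 s's div1r [1 / s ^+ 3]div1r.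
apply: (@le_trans _ _ ((4 * (3 * s ^+ 2 + x ^+ 2))^-1 - (s ^+ 2 * s ^+ 2)^-1)).
  by rewrite lerB.
have := t1; have := sqr_ge0 x; set t := s ^+ 2; set z := x ^+ 2; move=> z0 tg.
have q0 : 0 < 3 * t + z by lra.
have q1 : 0 < 3 * (t + 1) + z by lra.
have t0 : t != 0 by rewrite gt_eqF //; lra.
rewrite -subr_ge0.
(* The square is the excess of the continuous expression [B_t - B_xx / 2] over
   [1 / (4 * (3 * t + z))]. The term with [3 * z] is the cost of replacing [B_t] by a difference,
   and is at most [1 / t ^+ 2]. *)
have -> : (t + 1) / (3 * (t + 1) + z) - t / (3 * t + z) -
   6 * t * (z - t) / (3 * t + z) ^+ 3 / 2 - ((4 * (3 * t + z))^-1 - (t * t)^-1) =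
   3 * (z - t) ^+ 2 / (4 * (3 * t + z) ^+ 3) +
   ((t * t)^-1 - 3 * z / ((3 * t + z) ^+ 2 * (3 * (t + 1) + z))).
  by field; rewrite t0 !lt0r_neq0.
apply: addr_ge0.
  apply: divr_ge0; first by rewrite mulr_ge0 ?sqr_ge0.
  by rewrite mulr_ge0 // exprn_ge0 // ltW.
rewrite subr_ge0 ler_pdivrMr ?mulr_gt0 ?exprn_gt0 //.
rewrite [leRHS]mulrC ler_pdivlMr; last by rewrite mulr_gt0 //; lra.
have : t * t <= (3 * t + z) ^+ 2 by nra.
have : 3 * z <= 3 * (3 * (t + 1) + z) by lra.
move=> h1 h2.
have h3 : 3 * z * (t * t) <= 3 * (3 * (t + 1) + z) * ((3 * t + z) ^+ 2 / 9).
  apply: ler_pM => //; first lra; first nra.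
  nra.
nra.
Qed.

Lemma corr2_time x : `|corr2 s' x - corr2 s x| <= 3 / s ^+ 3.
Proof.
apply: (@le_trans _ _ (3 / (s ^+ 2 * s ^+ 2))); last by rewrite ler_wpM2l.
rewrite /corr2 s's.
have := t1; have := sqr_ge0 x; set t := s ^+ 2; set z := x ^+ 2; move=> z0 tg.
have q0 : 0 < 3 * t + z by lra.
have q1 : 0 < 3 * (t + 1) + z by lra.
have t0 : 0 < t by lra.
(* At time [u] the function [corr2] is [6 * a u * b u * c u], and the increment is split by the
   product rule. The factors [a], [b] are bounded, their increments and [c] are [O(1 / t)], and the
   increment of [c] is [O(1 / t ^+ 2)]. *)
pose a u := u / (3 * u + z); pose b u := (z - u) / (3 * u + z).
pose c u := (3 * u + z)^-1.
have -> : 6 * (t + 1) * (z - (t + 1)) / (3 * (t + 1) + z) ^+ 3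
  - 6 * t * (z - t) / (3 * t + z) ^+ 3 =
  6 * ((a (t + 1) - a t) * (b (t + 1) * c (t + 1)) + a t * ((b (t + 1) - b t) * c (t + 1))
    + a t * (b t * (c (t + 1) - c t))).
  by rewrite /a /b /c; field; rewrite !lt0r_neq0.
have aE : a (t + 1) - a t = z / ((3 * t + z) * (3 * (t + 1) + z)).
  by rewrite /a; field; rewrite !lt0r_neq0.
have bE : b (t + 1) - b t = - (4 * z / ((3 * t + z) * (3 * (t + 1) + z))).
  by rewrite /b; field; rewrite !lt0r_neq0.
have cE : c (t + 1) - c t = - (3 / ((3 * t + z) * (3 * (t + 1) + z))).
  by rewrite /c; field; rewrite !lt0r_neq0.
have tq : (3 * (t + 1) + z)^-1 <= (3 * t)^-1 by rewrite lef_pV2 ?posrE //; lra.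
have tq0 : (3 * t + z)^-1 <= (3 * t)^-1 by rewrite lef_pV2 ?posrE //; lra.
have b1 u : t <= u -> `|b u| <= 1.
  move=> tu; rewrite /b normrM [`|_^-1|]ger0_norm ?invr_ge0; last lra.
  by rewrite ler_pdivrMr ?mul1r ?ler_norml; [apply/andP; split|]; lra.
have a1 : `|a t| <= 1 / 3.
  rewrite /a ger0_norm ?divr_ge0 ?(ltW q0) ?(ltW t0) //.
  rewrite ler_pdivrMr //; lra.
have zq : z / ((3 * t + z) * (3 * (t + 1) + z)) <= (3 * t)^-1.
  rewrite invfM mulrA -[leRHS]mul1r; apply: ler_pM => //.
  - by rewrite divr_ge0 // ltW.
  - by rewrite invr_ge0 ltW.
  - by rewrite ler_pdivrMr // mul1r; lra.
have zq0 : 0 <= z / ((3 * t + z) * (3 * (t + 1) + z)) by rewrite divr_ge0 // mulr_ge0 // ltW.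
have c1 : `|c (t + 1)| <= (3 * t)^-1 by rewrite /c ger0_norm // invr_ge0 ltW.
have c2 : `|c (t + 1) - c t| <= 3 * ((3 * t)^-1 * (3 * t)^-1).
  have q2 : 0 <= (3 * t + z) * (3 * (t + 1) + z) by rewrite mulr_ge0 // ltW.
  rewrite cE normrN ger0_norm; last by rewrite divr_ge0.
  by apply: ler_wpM2l => //; rewrite invfM; apply: ler_pM => //; rewrite invr_ge0 ltW.
have a2 : `|a (t + 1) - a t| <= (3 * t)^-1 by rewrite aE ger0_norm.
have b2 : `|b (t + 1) - b t| <= 4 * (3 * t)^-1.
  rewrite bE normrN -mulrA ger0_norm; last by rewrite mulr_ge0.
  exact: ler_wpM2l.
rewrite normrM [`|6|]ger0_norm //.
have -> : 3 / (t * t) = 6 * ((9 / 2) * ((3 * t)^-1 * (3 * t)^-1)).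
  by field; exact: lt0r_neq0.
apply: ler_wpM2l => //.
have w0 : 0 <= (3 * t)^-1 by rewrite invr_ge0; lra.
have bt := b1 t (lexx _); have bt' : `|b (t + 1)| <= 1 by apply: b1; lra.
clear aE bE cE zq zq0 b1.
move: ((3 * t)^-1) w0 c1 c2 a2 b2 => w w0.
move: (b (t + 1) - b t) => db; move: (c (t + 1) - c t) => dc.
move: (a (t + 1) - a t) => da.
move: (a t) (b t) (b (t + 1)) (c (t + 1)) a1 bt bt'.
move=> a0 b0 b1 c1 a01 b01 b11 c1w dcw daw dbw.
have h1 : `|da * (b1 * c1)| <= w * (1 * w).
  by rewrite !normrM; apply: ler_pM => //; (exact: mulr_ge0 || exact: ler_pM).
have h2 : `|a0 * (db * c1)| <= 1 / 3 * (4 * w * w).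
  by rewrite !normrM; apply: ler_pM => //; (exact: mulr_ge0 || exact: ler_pM).
have h3 : `|a0 * (b0 * dc)| <= 1 / 3 * (1 * (3 * (w * w))).
  by rewrite !normrM; apply: ler_pM => //; (exact: mulr_ge0 || exact: ler_pM).
apply: le_trans (ler_normD _ _) _.
apply: le_trans (lerD (ler_normD _ _) (lexx _)) _.
have := mulr_ge0 w0 w0; lra.
Qed.

End TimeStep.
End Corrector.

(** * The mean absolute value of additive functionals *)

Section MartingaleAbs.
Variables (R : realType) (C : finType) (C_gt0 : (0 < #|C|)%N).
Variables (T : finType) (step : T -> C -> T).

Fixpoint path_sum (d : T -> C -> R) (x : T) (r : seq C) : R :=
  if r is c :: r' then d x c + path_sum d (step x c) r' else 0.

Lemma avg_norm_le (f : C -> R) e : (forall c, `|f c| <= e) -> `|avg f| <= e.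
Proof.
move=> fe; rewrite ler_norml; apply/andP; split.
  rewrite -(avg_cst C_gt0 (- e)); apply: le_avg => c.
  by have := fe c; rewrite ler_norml => /andP[].
rewrite -[leRHS](avg_cst C_gt0); apply: le_avg => c.
by have := fe c; rewrite ler_norml => /andP[].
Qed.

Variables (xi : T -> C -> R) (h : T -> R) (X H : R).
Hypotheses (xi_mean : forall x, avg (xi x) = 0)
  (xi_var : forall x, avg (fun c => xi x c ^+ 2) = 1 + h x - avg (fun c => h (step x c)))
  (xiX : forall x c, `|xi x c| <= X) (hH : forall x, `|h x| <= H).

Notation D f x a := (is_derive x (1 : R) (f : R -> R) a).

(** The first order term vanishes since [xi] has mean zero. By [xi_var] the second order term is
    [u2 / 2] up to a coboundary of [h], which the added term [h / 2 * u2] cancels; only third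
    derivatives remain. *)
Lemma avg_taylor (u u1 u2 u3 : R -> R) x y M :
  (forall z, D u z (u1 z)) -> (forall z, D u1 z (u2 z)) -> (forall z, D u2 z (u3 z)) ->
  (forall z, `|z - y| <= X -> `|u3 z| <= M) ->
  `|(u y + (1 + h x) / 2 * u2 y) -
    avg (fun c => u (y + xi x c) + h (step x c) / 2 * u2 (y + xi x c))|
  <= (X ^+ 3 + H * X / 2) * M.
Proof.
move=> ud u1d u2d u3M.
have -> : u y + (1 + h x) / 2 * u2 y = avg (fun c => u y + xi x c * u1 y
    + xi x c ^+ 2 / 2 * u2 y + h (step x c) / 2 * u2 y).
  transitivity (u y + u1 y * avg (xi x) + u2 y / 2 * avg (fun c => xi x c ^+ 2)
     + u2 y / 2 * avg (fun c => h (step x c))).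
    by rewrite xi_mean xi_var; field.
  rewrite -!avgM -[X in X + _ + _ + _](avg_cst C_gt0) -!avgD.
  by apply: eq_avg => c; field.
rewrite -avgB; apply: avg_norm_le => c.
have dE : y + xi x c - y = xi x c by rewrite addrC addKr.
have near_y : `|y + xi x c - y| <= X by rewrite dE.
have := taylor_order2 ud u1d u2d u3M near_y.
have := taylor_order0 u2d u3M near_y.
rewrite !dE => t0 t2.
have M0 : 0 <= M by apply: le_trans (u3M _ near_y).
have X0 : 0 <= X by apply: le_trans near_y.
have -> : u y + xi x c * u1 y + xi x c ^+ 2 / 2 * u2 y + h (step x c) / 2 * u2 y -
   (u (y + xi x c) + h (step x c) / 2 * u2 (y + xi x c)) =
  - (u (y + xi x c) - u y - xi x c * u1 y - xi x c ^+ 2 / 2 * u2 y)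
  - h (step x c) / 2 * (u2 (y + xi x c) - u2 y) by ring.
apply: le_trans (ler_normB _ _) _; rewrite normrN mulrDl; apply: lerD.
  apply: le_trans t2 _; rewrite mulrC; apply: ler_wpM2r => //.
  by rewrite lerXn2r ?nnegrE.
rewrite normrM (_ : H * X / 2 * M = H / 2 * (M * X)); last by ring.
apply: ler_pM => //.
  by rewrite normrM [`|2^-1|]ger0_norm // ler_wpM2r.
by apply: le_trans t0 _; apply: ler_wpM2l.
Qed.

Variables (E : R -> R).
Hypotheses (dE : forall x, D E x (gauss x)) (EN : forall x, E (- x) = - E x).

(** Time is shifted by one so that the comparison starts at [s = 1], away from the singularity of
    the heat solution. *)
Let s (n : nat) : R := Num.sqrt n.+1%:R.
Let s_sq n : s n ^+ 2 = n.+1%:R. Proof. by rewrite sqr_sqrtr. Qed.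
Let s_ge1 n : 1 <= s n. Proof. by rewrite -sqrtr1 ler_wsqrtr // ler1n. Qed.
Let s_gt0 n : 0 < s n. Proof. exact: lt_le_trans (s_ge1 n). Qed.
Let s_ge0 n : 0 <= s n. Proof. exact: ltW. Qed.
Let s_next n : s n.+1 ^+ 2 = s n ^+ 2 + 1. Proof. by rewrite !s_sq -[in LHS]natr1. Qed.

Let X_ge0 (x : T) : 0 <= X.
Proof. by have [c _] := card_gt0P C_gt0; apply: le_trans (xiX x c). Qed.
Let H_ge0 (x : T) : 0 <= H. Proof. by apply: le_trans (hH x). Qed.

(* The terms in [h] compensate the fluctuations of the conditional variance of [xi]. *)
Let U n x y := heat E (s n) y + h x / 2 * heat2 (s n) y.
Let G n x y := corr (s n) y + h x / 2 * corr2 (s n) y.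
Let B := X ^+ 3 + H * X / 2.
Let q n y := 3 * s n ^+ 2 + y ^+ 2.

(** The average over a letter and the step in time each contribute half of [heat2], and these
    contributions cancel. *)
Lemma heat_step n x y :
  `|U n.+1 x y - avg (fun c => U n (step x c) (y + xi x c))|
  <= B * (16 * (2 + X ^+ 2)) / q n y + (1 + H) / s n ^+ 3.
Proof.
have s0 := lt0r_neq0 (s_gt0 n).
have := @avg_taylor (heat E (s n)) (fun z => E (z / s n)) (heat2 (s n)) (heat3 (s n)) x y
  (16 * (2 + X ^+ 2) / q n y) (fun z => der_heat dE z s0) (fun z => der_heat1 dE z s0)
  (fun z => der_heat2 z s0) (fun z zy => heat3_near (s_ge1 n) zy).
have t1 := heat_time dE (s_ge1 n) (s_ge0 n.+1) (s_next n) y.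
have t2 := heat2_time (s_ge1 n) (s_ge0 n.+1) (s_next n) y.
rewrite -/B [leRHS]mulrA => t3.
rewrite /U; set a := avg _ in t3 *.
have -> : heat E (s n.+1) y + h x / 2 * heat2 (s n.+1) y - a =
  (heat E (s n) y + (1 + h x) / 2 * heat2 (s n) y - a) +
  ((heat E (s n.+1) y - heat E (s n) y - heat2 (s n) y / 2) +
   h x / 2 * (heat2 (s n.+1) y - heat2 (s n) y)) by field.
apply: le_trans (ler_normD _ _) _; apply: lerD.
  exact: t3.
apply: le_trans (ler_normD _ _) _; rewrite mulrDl; apply: lerD t1 _.
rewrite normrM (_ : H / s n ^+ 3 = H / 2 * (2 / s n ^+ 3)); last by field.
by apply: ler_pM => //; rewrite normrM [`|2^-1|]ger0_norm // ler_wpM2r.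
Qed.

Lemma corr_step n x y :
  1 / (4 * q n y) - (1 + 3 * H / 2 + 3 * B) / s n ^+ 3
  <= G n.+1 x y - avg (fun c => G n (step x c) (y + xi x c)).
Proof.
have := @avg_taylor (corr (s n)) (corr1 (s n)) (corr2 (s n)) (corr3 (s n)) x y
  (3 / s n ^+ 3) (fun z => der_corr z (s_gt0 n)) (fun z => der_corr1 z (s_gt0 n))
  (fun z => der_corr2 z (s_gt0 n)) (fun z _ => corr3_le z (s_gt0 n)).
have t1 := corr_time (s_ge1 n) (s_next n) y.
have t2 := corr2_time (s_ge1 n) (s_next n) y.
rewrite -/B /G; set a := avg _ => t3.
have t4 : `|h x / 2 * (corr2 (s n.+1) y - corr2 (s n) y)| <= H / 2 * (3 / s n ^+ 3).
  rewrite normrM; apply: ler_pM => //.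
  by rewrite normrM [`|2^-1|]ger0_norm // ler_wpM2r.
move: t3 t4; rewrite !ler_norml => /andP[t3 _] /andP[t4 _].
rewrite -/(q n y) in t1.
move: (s n ^+ 3) t1 t3 t4 => w t1 t3 t4.
have -> : (1 + 3 * H / 2 + 3 * B) / w = 1 / w + H / 2 * (3 / w) + B * (3 / w) by ring.
lra.
Qed.

(** The factors are chosen so that the gains of [corr_step] and [inv_time] absorb the errors of
    [heat_step]: [K1] undoes the 1/4 in front of [1 / q], and [K2] undoes the 1/6 in front of
    [1 / s ^+ 3], the loss made by [corr_step] included. *)
Let A1 := B * (16 * (2 + X ^+ 2)).
Let K1 := 4 * A1.
Let K2 := 6 * ((1 + H) + K1 * (1 + 3 * H / 2 + 3 * B)).
Let F n x y := K1 * G n x y - K2 / s n.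

Let B_ge0 (x : T) : 0 <= B.
Proof.
have X0 := X_ge0 x; have H0 := H_ge0 x.
by rewrite addr_ge0 ?exprn_ge0 // mulr_ge0 // mulr_ge0.
Qed.

Let K1_ge0 (x : T) : 0 <= K1.
Proof. by rewrite mulr_ge0 // mulr_ge0 ?(B_ge0 x) // mulr_ge0 // addr_ge0 ?sqr_ge0. Qed.

Let K2_ge0 (x : T) : 0 <= K2.
Proof.
rewrite mulr_ge0 // !addr_ge0 ?(H_ge0 x) // mulr_ge0 ?(K1_ge0 x) //.
by rewrite !addr_ge0 ?mulr_ge0 ?(H_ge0 x) ?(B_ge0 x).
Qed.

Lemma barrier_step n x y :
  `|U n.+1 x y - avg (fun c => U n (step x c) (y + xi x c))|
  <= F n.+1 x y - avg (fun c => F n (step x c) (y + xi x c)).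
Proof.
apply: le_trans (heat_step n x y) _.
have c1 := ler_wpM2l (K1_ge0 x) (corr_step n x y).
have c2 := ler_wpM2l (K2_ge0 x) (inv_time (s_ge1 n) (s_ge0 n.+1) (s_next n)).
rewrite /F avgB avgM (avg_cst C_gt0).
set a := avg _ in c1 *.
have s0 := lt0r_neq0 (s_gt0 n).
have q0 : q n y != 0 by rewrite lt0r_neq0 // corr_den_gt0.
have e1 : K1 * (1 / (4 * q n y) - (1 + 3 * H / 2 + 3 * B) / s n ^+ 3)
  = A1 / q n y - K1 * (1 + 3 * H / 2 + 3 * B) / s n ^+ 3.
  by rewrite /K1; move: A1 => A; field; rewrite ?q0 ?s0.
have e2 : K2 * (1 / (6 * s n ^+ 3)) =
  (1 + H) / s n ^+ 3 + K1 * (1 + 3 * H / 2 + 3 * B) / s n ^+ 3.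
  by rewrite /K2; move: K1 => K; field; rewrite ?s0.
rewrite e1 in c1; rewrite e2 in c2; rewrite -/A1.
lra.
Qed.

Lemma barrier_bound n x y : `|F n x y| <= K1 * (1 + H / 2) + K2.
Proof.
have K10 := K1_ge0 x; have K20 := K2_ge0 x; have H0 := H_ge0 x.
apply: le_trans (ler_normB _ _) _; apply: lerD.
  rewrite normrM ger0_norm //; apply: ler_wpM2l => //.
  apply: le_trans (ler_normD _ _) _; apply: lerD.
    by rewrite ger0_norm ?corr_ge0 // corr_le1.
  rewrite normrM -[leRHS]mulr1; apply: ler_pM => //.
    by rewrite normrM [`|2^-1|]ger0_norm // ler_wpM2r.
  exact: corr2_le1.
rewrite ger0_norm; last by rewrite divr_ge0.
by rewrite ler_pdivrMr //; apply: ler_peMr.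
Qed.

(** A discrete maximum principle: by [barrier_step], [U + F] is a supersolution and [U - F] a
    subsolution. Here [n] counts the letters still to be read, and the induction conditions on the
    first of them. *)
Lemma compare_heat (phi : R -> R) K :
  (forall x y, `|phi y - U 0 x y| <= K + F 0 x y) ->
  forall n x y, `|avgn n (fun r => phi (y + path_sum xi x r)) - U n x y| <= K + F n x y.
Proof.
move=> base; elim=> [|n IH] x y /=; first by rewrite addr0; apply: base.
have := barrier_step n x y; set a := avg (fun c => U _ _ _); set b := avg (fun c => F _ _ _).
move=> st.
have : `|avg (fun c => avgn n (fun r => phi (y + (xi x c + path_sum xi (step x c) r)))) - a|
   <= K + b.
  rewrite -avgB -(avg_cst C_gt0 K) -avgD.
  have le_avg_norm f g : (forall c, `|f c| <= g c) -> `|avg f| <= avg g :> R.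
    move=> fg; rewrite ler_norml -avgN; apply/andP; split; apply: le_avg => c;
    by have := fg c; rewrite ler_norml => /andP[].
  apply: le_avg_norm => c; apply: le_trans (IH (step x c) (y + xi x c)).
  rewrite le_eqVlt; apply/orP; left; apply/eqP; congr (`|_ - _|).
  by apply: eq_avgn => r _; rewrite addrA.
set w := avg _; move: st; rewrite !ler_norml => /andP[s1 s2] /andP[w1 w2].
apply/andP; split; lra.
Qed.

Variable kappa : R.
Hypotheses (kappa0 : 0 < kappa)
  (E_lim : forall x, 0 < x -> 0 <= kappa - E x <= 4 / x ^+ 2).

Lemma abs_heat_close : exists K, forall n x y,
  `|kappa * avgn n (fun r => `|y + path_sum xi x r|) - heat E (s n) y| <= K.
Proof.
pose K0 := K1 * (1 + H / 2) + K2.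
(* The bracket is the constant for the comparison at time 0. The other two terms bound the barrier
   and the variance correction at time [n]. *)
exists ((kappa + 6 + H / 2 + K0) + K0 + H / 2) => n x y.
have s01 : s 0 = 1 by rewrite /s sqrtr1.
have hb m x' y' : `|h x' / 2 * heat2 (s m) y'| <= H / 2.
  rewrite normrM -[leRHS]mulr1; apply: ler_pM => //.
    by rewrite normrM [`|2^-1|]ger0_norm // ler_wpM2r.
  rewrite /heat2 ger0_norm; last by rewrite divr_ge0 ?gauss_ge0.
  by rewrite ler_pdivrMr // mul1r (le_trans (gauss_le1 _)).
have base x' y' : `|kappa * `|y'| - U 0 x' y'| <= (kappa + 6 + H / 2 + K0) + F 0 x' y'.
  have h1 : `|kappa * `|y'| - heat E (s 0) y'| <= kappa + 6.
    by rewrite -[leRHS]mulr1 -[X in _ <= _ * X]s01; exact: heat_near.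
  have h2 := hb 0%N x' y'; have h3 := barrier_bound 0 x' y'.
  move: h1 h2 h3; rewrite /U -/K0 !ler_norml.
  move=> /andP[a1 a2] /andP[b1 b2] /andP[c1 c2].
  by apply/andP; split; lra.
have := compare_heat base n x y; rewrite avgnM.
have h2 := hb n x y; have h3 := barrier_bound n x y.
move: h2 h3; rewrite /U -/K0 !ler_norml.
move=> /andP[a1 a2] /andP[b1 b2] /andP[c1 c2].
by apply/andP; split; lra.
Qed.

End MartingaleAbs.

(** * Additive functionals of a finite chain *)

Section ChainSums.
Variables (R : realType) (C : finType) (C_gt0 : (0 < #|C|)%N).
Variables (T : finType) (step : T -> C -> T).

Lemma fin_bound (I : finType) (f : I -> R) : exists M, forall i, `|f i| <= M.
Proof.
exists (\sum_i `|f i|) => i; rewrite (bigD1 i) //= lerDl.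
by apply: sumr_ge0 => j _.
Qed.

(** The corrector telescopes, so the martingale and the centred sum differ by boundary terms
    only. *)
Lemma path_sum_corrector (d : T -> C -> R) s (h : T -> R) x r :
  path_sum step (fun x c => d x c + h (step x c) - h x - s) x r =
  path_sum step d x r - (size r)%:R * s + h (foldl step x r) - h x.
Proof.
elim: r x => [|c r IH] x /=; first by ring.
by rewrite IH -natr1; ring.
Qed.

Lemma path_sum_mul a (d : T -> C -> R) x r :
  path_sum step (fun x c => a * d x c) x r = a * path_sum step d x r.
Proof.
by elim: r x => [|c r IH] x /=; rewrite ?mulr0 // IH mulrDr.
Qed.

Lemma avgn_path_sum0 (d : T -> C -> R) n x : (forall x, avg (d x) = 0) ->
  avgn n (path_sum step d x) = 0.
Proof.
move=> d0; elim: n x => //= n IH x.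
rewrite (eq_avg (g := d x)) ?d0 // => c.
by rewrite avgnD (avgn_cst C_gt0) IH addr0.
Qed.

Variables (d : T -> C -> R) (s : R) (h : T -> R).
Hypothesis d_mean : forall x, avg (d x) = s + h x - markov step h x.

Let xi x c := d x c + h (step x c) - h x - s.

Let xi_mean x : avg (xi x) = 0.
Proof.
rewrite /xi; rewrite !avgD d_mean !(avg_cst C_gt0) /markov; ring.
Qed.

Lemma mean_path_sum : exists K, forall n x,
  `|avgn n (path_sum step d x) - s * n%:R| <= K.
Proof.
have [M hM] := fin_bound h; exists (M + M) => n x.
have := avgn_path_sum0 n x xi_mean.
rewrite (eq_avgn (Y := fun r => path_sum step d x r
    + (h (foldl step x r) - h x - n%:R * s))); last first.
  by move=> r rn; rewrite path_sum_corrector rn; ring.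
rewrite avgnD => /eqP; rewrite addr_eq0 => /eqP ->.
rewrite -avgnN -(avgn_cst C_gt0 n (s * n%:R)); apply: avgn_close => // r _.
have -> : - (h (foldl step x r) - h x - n%:R * s) - s * n%:R = h x - h (foldl step x r) by ring.
by apply: le_trans (ler_normB _ _) _; apply: lerD.
Qed.

Variable o : T.
Hypothesis reach : forall x, exists w, foldl step x w = o.
Hypothesis nondegenerate : forall x, exists c, xi x c != 0.

(** The martingale is normalized to mean variance 1, and the drift [(s - a) * n] becomes its
    starting point [y n]. There the heat solution is [kappa * |y n|] up to a bounded error if [s]
    differs from [a], and the square root of [n + 1] if they agree. *)
Theorem abs_path_sum : exists2 theta, 0 < theta & forall a, exists K, forall n x,
  `|avgn n (fun r => `|path_sum step d x r - a * n%:R|)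
    - (`|s - a| * n%:R + (if s == a then theta else 0) * Num.sqrt n%:R)| <= K.
Proof.
(* The conditional variance depends on the state; a second Poisson equation extracts its mean
   [sig2]. *)
have [sig2 [h2 h2P]] := poisson C_gt0 reach (fun x => avg (fun c => xi x c ^+ 2)).
have v_gt0 x : 0 < avg (fun c => xi x c ^+ 2).
  have [c xic] := nondegenerate x.
  rewrite /avg divr_gt0 ?ltr0n // (bigD1 c) //= ltr_pwDl ?sumr_ge0 //.
    by rewrite exprn_even_gt0.
  by move=> i _; rewrite sqr_ge0.
have sig0 : 0 < sig2.
  (* Otherwise [h2] would be strictly superharmonic everywhere, which is impossible at [o], where it
     is minimal. *)
  rewrite ltNge; apply/negP => sig0.
  have hm : forall x, - h2 x <= - h2 o.
    apply: (@harmonic_le _ _ C_gt0 _ step o reach (fun x => - h2 x)) => x.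
    rewrite /markov avgN lerN2 -/(markov step h2 x).
    by have := h2P x; have := v_gt0 x; lra.
  have := h2P o; have := v_gt0 o.
  have : h2 o <= markov step h2 o.
    rewrite -[leLHS](avg_cst C_gt0); apply: le_avg => c.
    by have := hm (step o c); rewrite lerN2.
  lra.
pose sig := Num.sqrt sig2; have sg0 : 0 < sig by rewrite sqrtr_gt0.
have sg2 : sig ^+ 2 = sig2 by rewrite sqr_sqrtr // ltW.
pose ze x c := sig^-1 * xi x c; pose h' x := sig2^-1 * h2 x.
have ze_mean x : avg (ze x) = 0 by rewrite avgM xi_mean mulr0.
have ze_var x : avg (fun c => ze x c ^+ 2) = 1 + h' x - avg (fun c => h' (step x c)).
  rewrite (eq_avg (g := fun c => sig2^-1 * xi x c ^+ 2)); last first.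
    by move=> c; rewrite /ze exprMn exprVn sg2.
  rewrite avgM h2P /h' avgM /markov; field; exact: lt0r_neq0.
have [X zeX] := fin_bound (fun p => ze p.1 p.2).
have {zeX} zeX x c : `|ze x c| <= X by apply: (zeX (x, c)).
have [H hH] := fin_bound h'.
have [E [dE EN]] := primitive_gauss R.
have [kappa [k0 E_lim]] := E_limit dE EN.
have [K closeK] := abs_heat_close C_gt0 ze_mean ze_var zeX hH dE EN k0 E_lim.
have [M hM] := fin_bound h.
(* This undoes both normalizations: the martingale was divided by [sig], and the heat solution
   starts from [kappa] times the absolute value. *)
exists (sig / kappa); first exact: divr_gt0.
move=> a.
pose y n := sig^-1 * ((s - a) * n%:R).
have main n x : `|avgn n (fun r => `|path_sum step d x r - a * n%:R|)
    - sig / kappa * heat E (Num.sqrt n.+1%:R) (y n)| <= M + M + sig / kappa * K.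
  pose Y := avgn n (fun r => sig * `|y n + path_sum step ze x r|).
  have h1 : `|avgn n (fun r => `|path_sum step d x r - a * n%:R|) - Y| <= M + M.
    apply: avgn_close => // r rn.
    have -> : sig * `|y n + path_sum step ze x r| =
       `|path_sum step d x r - a * n%:R + (h (foldl step x r) - h x)|.
      rewrite -{1}(gtr0_norm sg0) -normrM; congr `|_|.
      rewrite /y mulrDr mulrA divff ?lt0r_neq0 // mul1r path_sum_mul.
      rewrite mulrA divff ?lt0r_neq0 // mul1r path_sum_corrector rn; ring.
    apply: le_trans (ler_dist_dist _ _) _; rewrite opprD addNKr normrN.
    by apply: le_trans (ler_normB _ _) _; apply: lerD.
  have h2' : `|Y - sig / kappa * heat E (Num.sqrt n.+1%:R) (y n)| <= sig / kappa * K.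
    have sk : 0 <= sig / kappa by rewrite divr_ge0 // ltW.
    have -> : Y - sig / kappa * heat E (Num.sqrt n.+1%:R) (y n) = sig / kappa *
       (kappa * avgn n (fun r => `|y n + path_sum step ze x r|)
         - heat E (Num.sqrt n.+1%:R) (y n)).
      by rewrite /Y avgnM; field; exact: lt0r_neq0.
    by rewrite normrM ger0_norm //; apply: ler_wpM2l.
  apply: le_trans (lerD h1 h2'); rewrite -[X in `|X - _|](subrK Y) -addrA.
  exact: ler_normD.
have [K' heatK] : exists K', forall n, `|sig / kappa * heat E (Num.sqrt n.+1%:R) (y n)
   - (`|s - a| * n%:R + (if s == a then sig / kappa else 0) * Num.sqrt n%:R)| <= K'.
  have [sa|sa] := eqVneq s a.
    exists (sig / kappa) => n; rewrite /y sa subrr mul0r mulr0 heat0 normr0 mul0r add0r.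
    rewrite -mulrBr normrM ger0_norm ?divr_ge0 ?(ltW sg0) ?(ltW k0) //.
    rewrite -[leRHS]mulr1; apply: ler_wpM2l; first by rewrite divr_ge0 ?ltW.
    have sn : Num.sqrt (n%:R : R) <= Num.sqrt n.+1%:R by rewrite ler_wsqrtr // ler_nat.
    rewrite ger0_norm ?subr_ge0 // lerBlDl.
    rewrite -ler_sqr ?nnegrE ?addr_ge0 ?sqrtr_ge0 // sqrrD !sqr_sqrtr //.
    rewrite -[n.+1%:R]natr1 expr1n mulr1; have := sqrtr_ge0 (n%:R : R); rewrite mulr2n; lra.
  pose b := `|s - a|; have b0 : 0 < b by rewrite normr_gt0 subr_eq0.
  exists (sig / kappa * ((kappa + 6) + 12 * sig / b)) => n.
  rewrite mul0r addr0 -/b distrC.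
  have yn : `|y n| = b * n%:R / sig.
    by rewrite /y !normrM gtr0_norm ?invr_gt0 // (ger0_norm (ler0n _ n)) mulrC.
  have -> : b * n%:R = sig / kappa * (kappa * `|y n|).
    by rewrite yn; field; rewrite !lt0r_neq0.
  rewrite -mulrBr normrM ger0_norm ?divr_ge0 ?(ltW sg0) ?(ltW k0) //.
  apply: ler_wpM2l; first by rewrite divr_ge0 ?ltW.
  have sb0 : 0 <= 12 * sig / b by rewrite divr_ge0 ?mulr_ge0 ?ltW.
  (* Time 0 is separate because [y 0] vanishes, while [heat_far] divides by it. *)
  case: n yn => [|n] yn.
    apply: le_trans (heat_near dE EN E_lim _ k0 _) _; first by rewrite sqrtr_gt0.
    by rewrite sqrtr1 mulr1 lerDl.
  have n0 : 0 < (n.+1%:R : R) by rewrite ltr0n.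
  have y0 : 0 < `|y n.+1| by rewrite yn divr_gt0 // mulr_gt0.
  apply: le_trans (heat_far EN E_lim _ _) _; first by rewrite sqrtr_gt0.
    by rewrite -normr_gt0.
  apply: (@le_trans _ _ (12 * sig / b)); last by rewrite lerDr; lra.
  rewrite sqr_sqrtr // yn.
  have -> : 6 * n.+2%:R / (b * n.+1%:R / sig) = (6 * n.+2%:R / n.+1%:R) * (sig / b).
    by field; rewrite !lt0r_neq0.
  rewrite -[leRHS]mulrA; apply: ler_wpM2r; first by rewrite divr_ge0 ?ltW.
  rewrite ler_pdivrMr // -[n.+2%:R]natr1; have : 1 <= (n.+1%:R : R) by rewrite ler1n.
  lra.
exists (M + M + sig / kappa * K + K') => n x.
apply: le_trans (lerD (main n x) (heatK n)).
set w := sig / kappa * _; rewrite -[X in `|X - _|](subrK w) -addrA.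
exact: ler_normD.
Qed.

End ChainSums.

(** * The frog dynamics *)

Section Frogs.
Local Open Scope set_scope.
Local Open Scope nat_scope.
Variables (k : nat) (hk : (0 < k)%N).

Local Notation full_set := (@finset.setTfor 'I_k).
Local Notation no_set := (@finset.set0 'I_k).
Local Notation pad n := (residue hk n).
Local Notation W := (ord_tuple k).
Implicit Types (A : {set 'I_k}) (F : positions k) (c : 'I_k).

Lemma residueDl a y : pad (pad a + y) = pad (a + y).
Proof. by apply: val_inj => /=; rewrite modnDml. Qed.

Lemma residue_ord (c : 'I_k) : pad c = c.
Proof. by apply: val_inj => /=; rewrite modn_small. Qed.

Lemma residue0 c : pad (c + 0) = c. Proof. by rewrite addn0 residue_ord. Qed.

Lemma residueDk c : pad (c + k) = c.
Proof. by apply: val_inj; rewrite /= modnDr modn_small. Qed.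

Lemma residue_inj c a b : a < k -> b < k -> (pad (c + a) == pad (c + b)) = (a == b).
Proof. by move=> ak bk; rewrite -val_eqE /= eqn_modDl !modn_small. Qed.

Lemma residue_onto c x : exists2 y, y < k & pad (c + y) = x.
Proof.
exists ((x + (k - c)) %% k); first by rewrite ltn_mod.
apply: val_inj; rewrite /= modnDmr addnCA subnKC; last exact: ltnW.
by rewrite modnDr modn_small.
Qed.

Lemma find_iota (p : pred nat) b n y :
  y < n -> (forall z, z < y -> ~~ p (b + z)) -> p (b + y) -> find p (iota b n) = y.
Proof.
move=> yn before here.
have has_p : has p (iota b n).
  by apply/hasP; exists (b + y) => //; rewrite mem_iota leq_addr ltn_add2l.
apply/eqP; rewrite eqn_leq; apply/andP; split; rewrite leqNgt; apply/negP => lt.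
  by have := before_find 0 lt; rewrite nth_iota // here.
have := nth_find 0 has_p; rewrite nth_iota; last by rewrite -[n in _ < n](size_iota b) -has_find.
by apply/negP/before.
Qed.

(* This is [k] if [A] is the whole circle. *)
Definition hop A c := find (fun y => pad (c + y) \notin A) (iota 0 k).

Lemma hop_le A c : hop A c <= k.
Proof. by rewrite -[k in _ <= k](size_iota 0 k); apply: find_size. Qed.

Lemma hop_in A c y : y < hop A c -> pad (c + y) \in A.
Proof.
move=> yh; have yk := leq_trans yh (hop_le A c).
by have := before_find 0 yh; rewrite nth_iota // add0n => /negbFE.
Qed.

Lemma hop_notin A c : hop A c < k -> pad (c + hop A c) \notin A.
Proof.
move=> hk'; have := @nth_find _ 0 (fun y => pad (c + y) \notin A) (iota 0 k).
by rewrite has_find size_iota nth_iota // add0n; apply.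
Qed.

Lemma hop_eq A c y : y <= k -> (forall z, z < y -> pad (c + z) \in A) ->
  (y < k -> pad (c + y) \notin A) -> hop A c = y.
Proof.
move=> yk before here; apply/eqP; rewrite eqn_leq.
apply/andP; split; rewrite leqNgt; apply/negP => lt.
  have yk' := leq_trans lt (hop_le A c).
  by have := here yk'; rewrite hop_in.
by have := hop_notin (leq_trans lt yk); rewrite before.
Qed.

Lemma hop_eq0 A c : (hop A c == 0) = (c \notin A).
Proof.
apply/eqP/idP => [h0|cA].
  by have := @hop_notin A c; rewrite h0 residue0 => /(_ hk).
by apply: hop_eq => // _; rewrite residue0.
Qed.

Lemma hop_full c : hop full_set c = k.
Proof. by apply: hop_eq => //; rewrite ?ltnn // => z _; rewrite inE. Qed.

Lemma hop0 c : hop no_set c = 0.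
Proof. by apply/eqP; rewrite hop_eq0 inE. Qed.

(* When [c] is poked, the set of pads held by the [m] nastiest frogs changes in this way
   (see [lows_landed]). *)
Definition set_act A c := if c \in A then pad (c + hop A c) |: (A :\ c) else A.

Lemma hopU1_id A c f : f != pad (c + hop A c) -> hop (f |: A) c = hop A c.
Proof.
move=> fc; apply: hop_eq => [|z zh|hk']; first exact: hop_le.
  by rewrite in_setU1 hop_in // orbT.
by rewrite in_setU1 negb_or hop_notin // eq_sym fc.
Qed.

Section Hit.
Variables (A : {set 'I_k}) (c f : 'I_k).
Hypotheses (fA : f \notin A) (fc : f = pad (c + hop A c)).

Lemma hit_lt : hop A c < k.
Proof.
rewrite ltnNge; apply/negP => kh; case/negP: fA.
have [y yk <-] := residue_onto c f.
by apply: hop_in; apply: leq_trans kh.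
Qed.

Lemma hop_lt_hopU1 : hop A c < hop (f |: A) c.
Proof.
rewrite ltnNge; apply/negP => le_h.
have := hop_notin (leq_ltn_trans le_h hit_lt).
rewrite in_setU1 negb_or.
case: (ltngtP (hop (f |: A) c) (hop A c)) le_h => // [lt|->] _.
  by rewrite hop_in // andbF.
by rewrite -fc eqxx.
Qed.

(** Once the nastier frogs have settled they hold [set_act A c]. The frog dislodged from [f] skips
    the pads of [A] ahead of it, none of which is the vacated pad [c], and stops where the walk from
    [c] first leaves [f |: A]. *)
Lemma leap_after_hit :
  (find (fun y => pad (f + y) \notin set_act A c) (iota 1 k)).+1 = hop (f |: A) c - hop A c.
Proof.
have fE y : pad (f + y) = pad (c + (hop A c + y)) by rewrite {1}fc residueDl addnA.
have lt := hop_lt_hopU1; have h'k := hop_le (f |: A) c; have hk' := hit_lt.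
rewrite (@find_iota _ _ _ (hop (f |: A) c - hop A c).-1); last 1 first.
- rewrite add1n prednK ?subn_gt0 // fE subnKC; last exact: ltnW.
  rewrite /set_act; case: (ltngtP (hop (f |: A) c) k) h'k => // [h'k|h'k] _.
    have := hop_notin h'k; rewrite in_setU1 negb_or => /andP[nf nA].
    case: ifP => // cA; rewrite in_setU1 negb_or -fc nf in_setD1 negb_and nA orbT //.
  (* A full turn ends on [c] itself, which is free in [set_act A c]. *)
  rewrite h'k residueDk; case: ifPn => // cA.
  rewrite in_setU1 negb_or in_setD1 eqxx andbT /= -fc.
  by apply: contraNneq fA => <-.
- by rewrite prednK ?subn_gt0.
- have : hop (f |: A) c - hop A c <= k by rewrite (leq_trans (leq_subr _ _)).
  by case: (hop (f |: A) c - hop A c) (subn_gt0 (hop A c) (hop (f |: A) c)) => // ->.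
move=> z zlt; rewrite negbK fE add1n.
have lt' : hop A c + z.+1 < hop (f |: A) c.
  by move: zlt; rewrite -ltnS prednK ?subn_gt0 // ltn_subRL addnS.
have := hop_in lt'; rewrite in_setU1 {1}fc residue_inj //; last exact: leq_trans h'k.
rewrite -[X in _ == X]addn0 eqn_add2l /= => inA.
rewrite /set_act; case: ifP => // cA.
rewrite in_setU1 in_setD1 inA andbT; apply/orP; right.
rewrite -[X in _ != X]residue0 residue_inj //; first by rewrite addnS.
exact: leq_trans h'k.
Qed.

End Hit.

Lemma set_actU1_id A c f : f \notin A -> f != pad (c + hop A c) ->
  set_act (f |: A) c = f |: set_act A c.
Proof.
move=> fA fc; rewrite /set_act (hopU1_id fc) in_setU1.
case: (boolP (c \in A)) => cA.
  rewrite orbT; apply/finset.setP => x; rewrite !in_setU1 !in_setD1 in_setU1.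
  case: (eqVneq x f) => [->|_] //=.
  by rewrite (_ : f != c) ?orbT //; apply: contraNneq fA => ->.
move: fc; have /eqP -> : hop A c == 0 by rewrite hop_eq0.
by rewrite residue0 orbF eq_sym => /negbTE ->.
Qed.

Lemma set_actU1_hit A c f : f \notin A -> f = pad (c + hop A c) ->
  set_act (f |: A) c = pad (c + hop (f |: A) c) |: set_act A c.
Proof.
move=> fA fc; rewrite /set_act in_setU1.
case: (boolP (c \in A)) => cA.
  rewrite orbT -fc; congr (_ |: _); apply/finset.setP => x.
  rewrite in_setU1 !in_setD1 in_setU1.
  case: (eqVneq x f) => [->|] //=.
  by rewrite andbT; apply: contraNneq fA => ->.
have /eqP h0 : hop A c == 0 by rewrite hop_eq0.
have fc' : f = c by rewrite fc h0 residue0.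
by rewrite fc' eqxx /= setU1K.
Qed.

Lemma card_set_act A c : #|set_act A c| = #|A|.
Proof.
rewrite /set_act; case: ifP => // cA.
rewrite cardsU1 in_setD1 negb_and negbK.
have [hk'|] := boolP (hop A c < k).
  by rewrite hop_notin // orbT (cardsD1 c A) cA.
rewrite -leqNgt => kh; have -> : hop A c = k by apply/eqP; rewrite eqn_leq hop_le.
by rewrite residueDk eqxx (cardsD1 c A) cA.
Qed.

Definition lows F m := F @: [set i : 'I_k | i < m].

Lemma lows0 F : lows F 0 = no_set.
Proof.
by rewrite /lows (_ : [set i : 'I_k | i < 0] = no_set) ?imset0.
Qed.

Lemma lowsS F (m : 'I_k) : lows F m.+1 = F m |: lows F m.
Proof.
rewrite /lows -imsetU1 (_ : [set i : 'I_k | i < m.+1] = m |: [set i : 'I_k | i < m]) //.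
by apply/finset.setP => i; rewrite !inE ltnS leq_eqVlt.
Qed.

Lemma mem_lows F (m : 'I_k) n : injective F -> (F m \in lows F n) = (m < n).
Proof. by move=> Finj; rewrite mem_imset // inE. Qed.

Lemma lows_full F : injective F -> lows F k = full_set.
Proof.
move=> Finj; apply/eqP; rewrite eqEcard finset.subsetT /= cardsT card_imset //.
rewrite (_ : [set i : 'I_k | i < k] = full_set) ?cardsT //.
by apply/finset.setP => i; rewrite !inE ltn_ord.
Qed.

Lemma card_lows F m : injective F -> m <= k -> #|lows F m| = m.
Proof.
move=> Finj mk; rewrite card_imset //.
rewrite cardsE -sum1_card (eq_bigl (fun i : 'I_k => i < m)) //.
by rewrite -(big_ord_widen k (fun=> 1)) // sum1_card card_ord.
Qed.

Section OneStep.
Variables (F : positions k) (c : 'I_k).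
Hypothesis Finj : injective F.

(* The total distance leapt by the [m] nastiest frogs. *)
Definition level m := hop (lows F m) c.

Definition jump (m : 'I_k) := level m.+1 - level m.

Lemma level0 : level 0 = 0. Proof. by rewrite /level lows0 hop0. Qed.

Lemma levelk : level k = k. Proof. by rewrite /level lows_full // hop_full. Qed.

Let Fm_notin (m : 'I_k) : F m \notin lows F m.
Proof. by rewrite mem_lows // ltnn. Qed.

Lemma level_id (m : 'I_k) : F m != pad (c + level m) -> level m.+1 = level m.
Proof. by move=> Fm; rewrite /level lowsS hopU1_id. Qed.

Lemma level_hit (m : 'I_k) : F m = pad (c + level m) -> level m < level m.+1.
Proof. by move=> Fm; rewrite /level lowsS hop_lt_hopU1. Qed.

Lemma level_leS (m : 'I_k) : level m <= level m.+1.
Proof.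
have [/level_hit/ltnW //|/level_id -> //] := eqVneq (F m) (pad (c + level m)).
Qed.

Lemma jumpK (m : 'I_k) : level m + jump m = level m.+1.
Proof. by rewrite subnKC // level_leS. Qed.

Lemma jump_gt0 (m : 'I_k) : (0 < jump m) = (F m == pad (c + level m)).
Proof.
rewrite subn_gt0; apply/idP/eqP => [|/level_hit //].
by case: (eqVneq (F m) (pad (c + level m))) => // /level_id ->; rewrite ltnn.
Qed.

Definition landed : positions k := [ffun m => pad (F m + jump m)].

Lemma landed_hit (m : 'I_k) : F m = pad (c + level m) -> landed m = pad (c + level m.+1).
Proof. by move=> Fm; rewrite ffunE {1}Fm residueDl -addnA jumpK. Qed.

Lemma landed_id (m : 'I_k) : F m != pad (c + level m) -> landed m = F m.
Proof.
by move=> Fm; rewrite ffunE /jump (level_id Fm) subnn residue0.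
Qed.

(** The set held by the nastiest frogs evolves autonomously, whatever the arrangement of the frogs
    inside it. Frogs are added one at a time: the next one either stands on the current landing pad
    and carries the walk further, or stays put. *)
Lemma lows_landed m : m <= k -> lows landed m = set_act (lows F m) c.
Proof.
elim: m => [|m IH] mk.
  by rewrite !lows0 /set_act inE.
have -> : m = Ordinal mk by [].
rewrite !lowsS (IH (ltnW mk)).
have [Fm|Fm] := eqVneq (F (Ordinal mk)) (pad (c + level m)).
  by rewrite (landed_hit Fm) (set_actU1_hit (Fm_notin _) Fm) /level lowsS.
by rewrite (landed_id Fm) (set_actU1_id (Fm_notin _) Fm).
Qed.

Lemma landed_inj : injective landed.
Proof.
have : #|lows landed k| = k.
  by rewrite lows_landed // card_set_act card_lows.
rewrite /lows (_ : [set i : 'I_k | i < k] = full_set); last first.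
  by apply/finset.setP => i; rewrite !inE ltn_ord.
move=> card_k x y; have /imset_injP inj : #|landed @: full_set| == #|full_set|.
  by rewrite card_k cardsT card_ord.
by apply: inj; rewrite inE.
Qed.

(* The state reached when every frog nastier than [m] has calmed down. *)
Let stage m := FrogState [ffun j : 'I_k => if j < m then landed j else F j]
  [set j : 'I_k | (m <= j) && (F j == pad (c + level m))]
  [ffun j : 'I_k => if j < m then jump j else 0].

Lemma stage_id (m : 'I_k) : F m != pad (c + level m) -> stage m.+1 = stage m.
Proof.
move=> Fm; rewrite /stage level_id //; congr FrogState.
- apply/ffunP => j; rewrite !ffunE ltnS leq_eqVlt.
  case: (eqVneq (j : nat) m) => [/val_inj ->|_] //=.
  by rewrite ltnn /jump level_id // subnn residue0.
- apply/finset.setP => j; rewrite !inE [m <= j]leq_eqVlt.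
  case: (eqVneq (m : nat) j) => [/val_inj <-|_] //=.
  by rewrite ltnn (negbTE Fm).
- apply/ffunP => j; rewrite !ffunE ltnS leq_eqVlt.
  case: (eqVneq (j : nat) m) => [/val_inj ->|_] //=.
  by rewrite ltnn /jump level_id // subnn.
Qed.

(** As [F] is injective, [m] is the only agitated frog. The pads it must avoid form
    [set_act (lows F m) c], so that [leap_after_hit] gives the length of its leap. *)
Lemma stage_hit (m : 'I_k) : F m = pad (c + level m) -> stage m.+1 = frog_step hk (stage m).
Proof.
move=> Fm.
have agit : agitated (stage m) = [set m].
  apply/finset.setP => j; rewrite !inE -Fm (inj_eq Finj).
  by case: (eqVneq j m) => [->|]; rewrite ?leqnn ?andbF.
rewrite /frog_step.
have -> : nastiest (agitated (stage m)) = Some m.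
  rewrite /nastiest agit; case: pickP => [i|/(_ m)].
    by rewrite inE => /andP[/eqP -> _].
  rewrite inE eqxx /= => /negP []; apply/forallP => j.
  by rewrite inE; apply/implyP => /eqP ->.
have leapE : leap hk (pos (stage m)) m = jump m.
  rewrite /leap /jump /level lowsS -(leap_after_hit (Fm_notin m) Fm) -lows_landed; last exact: ltnW.
  congr _.+1; apply: eq_find => y /=; rewrite ffunE ltnn; congr (~~ _).
  apply/existsP/imsetP => [[j /andP[jm]]|[j]].
    by rewrite ffunE jm => /eqP <-; exists j; rewrite ?inE.
  by rewrite inE => jm ->; exists j; rewrite jm ffunE jm eqxx.
have posE j : pos (stage m) j = if j < m then landed j else F j by rewrite ffunE.
have leaptE j : leapt (stage m) j = if j < m then jump j else 0 by rewrite ffunE.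
rewrite leapE agit posE ltnn.
have jm_neq (j : 'I_k) : j != m -> ((j : nat) == m) = false by move=> jm; apply/negbTE.
congr FrogState.
- apply/ffunP => j; rewrite [LHS]ffunE [RHS]ffunE posE ltnS leq_eqVlt.
  by case: (eqVneq j m) => [->|/jm_neq ->] //=; rewrite eqxx /= ffunE.
- apply/finset.setP => j; rewrite [in LHS]inE [in RHS]inE posE finset.in_set1.
  case: (eqVneq j m) => [->|jm] /=; first by rewrite ltnn.
  rewrite ltn_neqAle eq_sym jm_neq //=.
  case: (ltnP j m) => jm' /=; last by rewrite {1}Fm residueDl -addnA jumpK.
  have -> : pad (F m + jump m) = landed m by rewrite ffunE.
  by rewrite (inj_eq landed_inj) (negbTE jm).
- apply/ffunP => j; rewrite [LHS]ffunE [RHS]ffunE leaptE ltnS leq_eqVlt.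
  by case: (eqVneq j m) => [->|/jm_neq ->] //=; rewrite eqxx.
Qed.

Lemma final_stage : final_state hk W F c = stage k.
Proof.
(* A frog that is not hit consumes no step, so at most [m] steps lead to [stage m]. The steps left
   over at the end do nothing, since nobody is agitated in [stage k]. *)
have reach m : m <= k -> exists2 i, i <= m & stage m = iter i (frog_step hk) (initial_state W F c).
  elim: m => [|m IH] mk.
    exists 0 => //=; rewrite /stage /initial_state; congr FrogState.
    - by apply/ffunP => j; rewrite !ffunE.
    - by apply/finset.setP => j; rewrite !inE level0 residue0 tnth_ord_tuple.
  have [i im e] := IH (ltnW mk).
  have [Fm|Fm] := eqVneq (F (Ordinal mk)) (pad (c + level (Ordinal mk))).
    by exists i.+1 => //; rewrite iterS -e -(stage_hit Fm).
  by exists i; [exact: leqW|rewrite -e -(stage_id Fm)].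
have [i ik e] := reach k (leqnn k).
have calm j : iter j (frog_step hk) (stage k) = stage k.
  elim: j => //= j ->; rewrite /frog_step (_ : nastiest _ = None) // /nastiest.
  by case: pickP => // x; rewrite inE /= leqNgt ltn_ord.
by rewrite /final_state -(calm (k - i)) e -iterD subnK.
Qed.

Lemma actE : act hk W F c = landed.
Proof. by rewrite /act final_stage; apply/ffunP => j; rewrite ffunE ltn_ord. Qed.

Lemma displacementE m : displacement hk W m F c = jump m.
Proof. by rewrite /displacement final_stage ffunE ltn_ord. Qed.

Lemma act_inj : injective (act hk W F c).
Proof. by rewrite actE; apply: landed_inj. Qed.

End OneStep.
End Frogs.

(** * Irreducibility, stationarity and counting for the set dynamics *)

Section Reachability.
Local Open Scope set_scope.
Local Open Scope nat_scope.
Variables (k : nat) (hk : (0 < k)%N).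
Local Notation full_set := (@finset.setTfor 'I_k).
Local Notation pad n := (residue hk n).
Local Notation W := (ord_tuple k).
Local Notation act := (act hk W).
Local Notation act_word := (act_word hk W).
Implicit Types (A : {set 'I_k}) (F : positions k) (c : 'I_k).

Lemma act_word_inj F w : injective F -> injective (act_word F w).
Proof.
by elim: w F => //= c w IH F Finj; apply: IH; apply: act_inj.
Qed.

Lemma lows_act F c m : injective F -> m <= k -> lows (act F c) m = set_act hk (lows F m) c.
Proof. by move=> Finj mk; rewrite actE // lows_landed. Qed.

Lemma lows_act_word F w m : injective F -> m <= k ->
  lows (act_word F w) m = foldl (set_act hk) (lows F m) w.
Proof.
elim: w F => //= c w IH F Finj mk; rewrite IH ?lows_act //; exact: act_inj.
Qed.

(** With the nastier frogs at home on pads [0, ..., m - 1], frog [m] is poked repeatedly. Each poke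
    moves it one pad ahead until it sits on the last pad; the next one makes it leap over the
    nastier frogs to pad [m]. *)
Lemma poke_id F (m : 'I_k) : injective F -> (forall i : 'I_k, i < m -> F i = i) ->
  exists w, forall i : 'I_k, i <= m -> act_word F w i = i.
Proof.
have [n] := ubnP (k - F m); elim: n F => // n IH F lt_n Finj Fid.
have [Fm|Fm] := eqVneq (F m) m.
  exists [::] => i; rewrite leq_eqVlt => /orP[/eqP/val_inj -> //|]; exact: Fid.
have mem_low x i : i <= m -> (x \in lows F i) = (x < i).
  move=> im; apply/imsetP/idP => [[j]|xi].
    by rewrite inE => ji ->; rewrite Fid // (leq_trans ji).
  by exists x; rewrite ?inE // Fid // (leq_trans xi).
have mFm : m < F m.
  rewrite ltn_neqAle eq_sym Fm /= leqNgt; apply/negP => lt.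
  by have := Fid _ lt; move/Finj => e; rewrite e ltnn in lt.
set c := F m.
have lev0 i : i <= m -> level hk F c i = 0.
  move=> im; apply/eqP; rewrite hop_eq0 mem_low // -leqNgt.
  exact: leq_trans im (ltnW mFm).
have G_low (i : 'I_k) : i < m -> act F c i = i.
  move=> im; have ne : F i != pad (c + level hk F c i).
    by rewrite lev0 ?(ltnW im) // residue0 Fid // neq_ltn (ltn_trans im mFm).
  by rewrite actE // landed_id // Fid.
have G_m : act F c m = pad (c + level hk F c m.+1).
  by rewrite actE // landed_hit // lev0 // residue0.
have lowS x : (x \in lows F m.+1) = (x == c) || (x < m).
  by rewrite lowsS in_setU1 mem_low.
have [ck|ck] := ltnP c.+1 k.
  have l1 : level hk F c m.+1 = 1.
    apply: hop_eq; first exact: leq_trans ck.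
      by case=> // _; rewrite residue0 lowS eqxx.
    rewrite lowS -val_eqE /= addn1 modn_small // => _.
    by rewrite negb_or gtn_eqF //= -leqNgt ltnW // ltnW.
  have GmE : act F c m = c.+1 :> nat by rewrite G_m l1 /= addn1 modn_small.
  have [|w wP] := IH (act F c) _ (act_inj Finj) G_low.
    by rewrite GmE; move: lt_n; rewrite -/c; lia.
  by exists (c :: w).
(* From the last pad the walk wraps around, skips the pads below [m] and stops at [m], at distance
   [m + 1]. *)
have ck' : c.+1 = k by apply/eqP; rewrite eqn_leq ck ltn_ord.
have mk : m.+1 < k by move: mFm ck'; rewrite -/c; lia.
have padE z : z < k -> pad (c + z.+1) = z :> nat.
  by move=> zk; rewrite /= addnS -addSn ck' modnDl modn_small.
have l1 : level hk F c m.+1 = m.+1.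
  apply: hop_eq; first exact: ltnW.
    case=> [|z] zm; first by rewrite residue0 lowS eqxx.
    by rewrite lowS padE ?(zm : z < m) ?orbT //; apply: ltn_trans (zm : z < m) _.
  move=> _; rewrite lowS negb_or padE // ltnn andbT.
  by apply: contraTneq mFm => e; rewrite -/c -e padE // ltnn.
exists [:: c] => i; rewrite leq_eqVlt => /orP[/eqP/val_inj ->|]; last exact: G_low.
by rewrite /= G_m l1; apply: ord_inj; rewrite padE.
Qed.

Definition id_arrangement : positions k := [ffun i => i].

Lemma id_arrangement_inj : injective id_arrangement.
Proof. by move=> i j; rewrite !ffunE. Qed.

Lemma reach_id F : injective F -> exists w, act_word F w = id_arrangement.
Proof.
move=> Finj.
have [w wP] : exists w, forall i : 'I_k, i < k -> act_word F w i = i.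
  suff H m : m <= k -> exists w, forall i : 'I_k, i < m -> act_word F w i = i by apply: H.
  elim: m => [|m IH] mk; first by exists [::].
  have [w wP] := IH (ltnW mk).
  have [w' w'P] := @poke_id _ (Ordinal mk) (act_word_inj (w := w) Finj) wP.
  by exists (w ++ w'); rewrite /Defs.act_word foldl_cat.
by exists w; apply/ffunP => i; rewrite ffunE wP.
Qed.

Lemma lows_onto A : exists2 F : positions k, injective F & lows F #|A| = A.
Proof.
pose s := enum A ++ enum (~: A).
have s_uniq : uniq s.
  rewrite cat_uniq !enum_uniq /= andbT; apply/hasPn => x.
  by rewrite !mem_enum inE.
have size_s : size s = k by rewrite size_cat -!cardE cardsC card_ord.
pose F : positions k := [ffun i => nth i s i].
have FE i : F i = nth (Ordinal hk) s i.
  by rewrite ffunE; apply: set_nth_default; rewrite size_s.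
exists F => [i j|].
  by rewrite !FE => /eqP; rewrite nth_uniq ?size_s // => /eqP/val_inj.
apply/eqP; rewrite eqEcard; apply/andP; split; last first.
  rewrite card_lows //; last by rewrite -[k in _ <= k]card_ord max_card.
  by move=> i j; rewrite !FE => /eqP; rewrite nth_uniq ?size_s // => /eqP/val_inj.
apply/fintype.subsetP => _ /imsetP[i + ->]; rewrite inE => iA.
by rewrite FE nth_cat -cardE iA -mem_enum mem_nth // -cardE.
Qed.

Lemma set_act_reach A : exists w, foldl (set_act hk) A w = lows id_arrangement #|A|.
Proof.
have [F Finj FA] := lows_onto A; have [w wF] := reach_id Finj.
exists w; rewrite -wF lows_act_word ?FA //.
by rewrite -[k in _ <= k]card_ord max_card.
Qed.

Definition landing (p : {set 'I_k} * 'I_k) := (set_act hk p.1 p.2, pad (p.2 + hop hk p.1 p.2)).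

(* Reading the circle backwards from the landing pad recovers the departure pad. *)
Lemma landing_inj : injective landing.
Proof.
pose back (B : {set 'I_k}) (z : 'I_k) := find (fun y => pad (z + (k - y)) \notin B) (iota 0 k).
pose undo (q : {set 'I_k} * 'I_k) := let c := pad (q.2 + (k - back q.1 q.2)) in
  (if back q.1 q.2 == 0 then q.1 else c |: (q.1 :\ q.2), c).
suff landingK : cancel landing undo by exact: can_inj landingK.
move=> [A c]; rewrite /landing /=.
set h := hop hk A c; set z := pad (c + h); set B := set_act hk A c.
have hk' : h <= k := hop_le hk A c.
have backE : back B z = h.
  have zE y : y <= h -> pad (z + (k - y)) = pad (c + (h - y)).
    move=> yh; rewrite residueDl; apply: val_inj => /=.
    have -> : c + h + (k - y) = c + (h - y) + k by lia.
    by rewrite modnDr.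
  have before y : y < h -> pad (z + (k - y)) \in B.
    move=> yh; rewrite zE ?(ltnW yh) // /B /set_act -/h.
    have cA : c \in A by apply: contraLR yh; rewrite -hop_eq0 -/h => /eqP ->.
    rewrite cA in_setU1 in_setD1; case: y yh => [|y] yh; first by rewrite subn0 eqxx.
    rewrite hop_in ?andbT; last by rewrite -/h; lia.
    apply/orP; right; rewrite -[X in _ != X](residue0 hk) residue_inj //; lia.
  have here : h < k -> pad (z + (k - h)) \notin B.
    move=> hlt; rewrite zE // subnn residue0 /B /set_act; case: ifPn => // cA.
    rewrite in_setU1 in_setD1 eqxx orbF -/h -{1}(residue0 hk c) residue_inj //.
    by rewrite eq_sym hop_eq0 cA.
  rewrite /back; case: (ltngtP h k) hk' => // [hlt|hE] _.
    by apply: find_iota => // [y yh|]; [rewrite negbK before|rewrite here].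
  rewrite hE -[RHS](size_iota 0 k); apply: hasNfind; apply/hasPn => y.
  by rewrite mem_iota /= add0n -{1}hE => /before ->.
rewrite /undo /= backE.
have zc : pad (z + (k - h)) = c.
  rewrite residueDl -addnA subnKC //; exact: residueDk.
rewrite zc; congr (_, _).
rewrite hop_eq0; case: ifPn => cA; first by rewrite /B /set_act (negbTE cA).
rewrite negbK in cA; rewrite /B /set_act cA -/h -/z.
have [hlt|kh] := ltnP h k.
  rewrite finset.setU1K; first by rewrite finset.setD1K.
  by rewrite in_setD1 negb_and hop_notin // orbT.
have hE : h = k by apply/eqP; rewrite eqn_leq hk'.
by rewrite /z hE residueDk finset.setD1K // finset.setD1K.
Qed.

(** Stationarity of the uniform distribution on [m]-subsets: an injection of a finite type into
    itself is a permutation, and [set_act] is the first component of [landing]. *)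
Lemma sum_set_act (R : nmodType) (phi : {set 'I_k} -> R) m :
  (\sum_(A : {set 'I_k} | #|A| == m) \sum_c phi (set_act hk A c) =
   (\sum_(A : {set 'I_k} | #|A| == m) phi A) *+ k)%R.
Proof.
have -> : ((\sum_(A : {set 'I_k} | #|A| == m) phi A) *+ k =
    \sum_(A : {set 'I_k} | #|A| == m) \sum_(c : 'I_k) phi A)%R.
  by rewrite -sumrMnl; apply: eq_bigr => A _; rewrite sumr_const card_ord.
rewrite !pair_big_dep /= [in RHS](reindex_inj landing_inj) /=.
by apply: eq_bigl => -[A c] /=; rewrite card_set_act.
Qed.

Lemma card_superset (B : {set 'I_k}) m : m <= k ->
  #|[set A : {set 'I_k} | (B \subset A) && (#|A| == m)]| = 'C(k - #|B|, k - m).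
Proof.
move=> mk; rewrite -(card_imset _ (@finset.setC_inj _)).
have -> : k - #|B| = #|~: B| by rewrite [in RHS]cardsCs finset.setCK card_ord.
rewrite -cards_draws; congr #|pred_of_set _|; apply/finset.setP => A.
rewrite inE; apply/imsetP/andP => [[A' + ->]|[AB /eqP Am]].
  rewrite inE => /andP[BA /eqP Am]; rewrite finset.setCS BA; split=> //.
  by rewrite cardsCs finset.setCK card_ord Am.
exists (~: A); last by rewrite finset.setCK.
rewrite inE finset.subsetC AB cardsCs finset.setCK card_ord Am; apply/eqP; lia.
Qed.

Lemma sum_bin n r : \sum_(j < n) 'C(j, r) = 'C(n, r.+1).
Proof.
elim: n => [|n IH]; first by rewrite big_ord0.
by rewrite big_ord_recr /= IH binS.
Qed.

(** The hop exceeds [y] iff the arc [I y] of [y + 1] pads starting at [c] lies in [A]. Counting the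
    [m]-subsets that contain each arc leaves the binomial sum [sum_bin]. *)
Lemma sum_hop m c : m <= k ->
  \sum_(A : {set 'I_k} | #|A| == m) hop hk A c = 'C(k, (k - m).+1).
Proof.
move=> mk; pose I y := [set pad (c + z) | z : 'I_k & z <= y].
have hopE A : hop hk A c = \sum_(y < k) (I y \subset A).
  transitivity (\sum_(y < k | y < hop hk A c) 1).
    by rewrite -(big_ord_widen k (fun=> 1)) ?hop_le // sum1_card card_ord.
  rewrite big_mkcond; apply: eq_bigr => y _.
  suff -> : (y < hop hk A c) = (I y \subset A) by [].
  apply/idP/fintype.subsetP => [yh _ /imsetP[z + ->]|IA].
    by rewrite inE => zy; apply: hop_in; apply: leq_ltn_trans zy yh.
  rewrite ltnNge; apply/negP => hy; have hlt := leq_ltn_trans hy (ltn_ord y).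
  have /negP[] := hop_notin hlt; apply: IA.
  by apply/imsetP; exists (Ordinal hlt) => //; rewrite inE.
rewrite (eq_bigr _ (fun A _ => hopE A)) exchange_big /=.
rewrite -sum_bin (reindex_inj rev_ord_inj) /=; apply: eq_bigr => y _.
rewrite -big_mkcondr /= sum1dep_card.
transitivity #|[set A : {set 'I_k} | (I (k - y.+1) \subset A) && (#|A| == m)]|.
  by apply: eq_card => A; rewrite !inE andbC.
rewrite card_superset // card_imset; last first.
  by move=> z z' /eqP; rewrite residue_inj // => /eqP/val_inj.
rewrite cardsE -sum1_card.
have yk := ltn_ord y.
rewrite -(@big_ord_widen_cond _ _ _ (k - y.+1).+1 k xpredT (fun=> 1)).
  by rewrite sum1_card card_ord; congr 'C(_, _); lia.
lia.
Qed.

End Reachability.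

(** * Longest common subsequences and lifted frogs *)

Section LcsRecursion.
Local Open Scope nat_scope.
Variable Sigma : finType.
Implicit Types (V s r w : seq Sigma) (c a : Sigma).

Lemma lcs_geP V V' l :
  reflect (exists s, [/\ size s = l, subseq s V & subseq s V']) (l <= lcs V V').
Proof.
apply: (iffP idP) => [ll|[s [<- sV sV']]].
  have [s [sV sV' sl]] : exists s, [/\ subseq s V, subseq s V' & l <= size s].
    rewrite /lcs in ll; case: l ll => [|l] ll; first by exists [::]; rewrite !sub0seq.
    have [i /existsP[s /andP[sV sV']] il] : exists2 i : 'I_(size V).+1,
        [exists s : i.-tuple Sigma, subseq s V && subseq s V'] & l.+1 <= i.
      apply/exists_inP; apply: contraTT ll => /exists_inPn ll.
      by rewrite -leqNgt; apply/bigmax_leqP => i /ll; rewrite -leqNgt.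
    by exists s; rewrite size_tuple.
  exists (take l s); split; first by rewrite size_takel.
    exact: subseq_trans (take_subseq _ _) sV.
  exact: subseq_trans (take_subseq _ _) sV'.
have sl : size s < (size V).+1 by rewrite ltnS size_subseq.
rewrite /lcs -[X in X <= _]/(nat_of_ord (Ordinal sl)); apply: leq_bigmax_cond.
by apply/existsP; exists (in_tuple s); rewrite /= sV.
Qed.

Lemma lcs_subseq s V V' : subseq s V -> subseq s V' -> size s <= lcs V V'.
Proof. by move=> sV sV'; apply/lcs_geP; exists s. Qed.

Lemma lcs_max V V' : exists s, [/\ size s = lcs V V', subseq s V & subseq s V'].
Proof. exact/lcs_geP. Qed.

Lemma lcs_nill V : lcs [::] V = 0.
Proof.
by apply/eqP; have [s [<-]] := lcs_max [::] V; rewrite subseq0 => /eqP ->.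
Qed.

Lemma lcs_nilr V : lcs V [::] = 0.
Proof.
by apply/eqP; have [s [<- _]] := lcs_max V [::]; rewrite subseq0 => /eqP ->.
Qed.

Lemma subseq_rcons s x r c :
  subseq (rcons s x) (rcons r c) = if x == c then subseq s r else subseq (rcons s x) r.
Proof.
rewrite -subseq_rev !rev_rcons /=; case: ifP => _; first by rewrite subseq_rev.
by rewrite -rev_rcons subseq_rev.
Qed.

Lemma subseq_rcons_r r c : subseq r (rcons r c).
Proof. by rewrite -cats1 prefix_subseq. Qed.

Lemma lcs_rcons_eq r w c : lcs (rcons r c) (rcons w c) = (lcs r w).+1.
Proof.
apply/eqP; rewrite eqn_leq; apply/andP; split; last first.
  have [s [<- sr sw]] := lcs_max r w.
  rewrite -(size_rcons s c); apply: lcs_subseq; by rewrite subseq_rcons eqxx.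
have [s [<-]] := lcs_max (rcons r c) (rcons w c).
case/lastP: s => // s x; rewrite !subseq_rcons size_rcons; case: ifP => _ sr sw.
  by rewrite ltnS lcs_subseq.
by rewrite -(size_rcons s x) leqW // lcs_subseq.
Qed.

Lemma lcs_rcons_neq r w c a : a != c ->
  lcs (rcons r c) (rcons w a) = maxn (lcs (rcons r c) w) (lcs r (rcons w a)).
Proof.
move=> ac; apply/eqP; rewrite eqn_leq; apply/andP; split; last first.
  rewrite geq_max; apply/andP; split.
    have [s [<- sr sw]] := lcs_max (rcons r c) w.
    by apply: lcs_subseq => //; apply: subseq_trans sw (subseq_rcons_r _ _).
  have [s [<- sr sw]] := lcs_max r (rcons w a).
  by apply: lcs_subseq => //; apply: subseq_trans sr (subseq_rcons_r _ _).
have [s [<-]] := lcs_max (rcons r c) (rcons w a).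
case/lastP: s => // s x; rewrite leq_max => sr sw; apply/orP.
move: (sr); rewrite subseq_rcons; case: eqP => [xc _|_ sr'].
  left; apply: lcs_subseq => //; move: sw.
  by rewrite subseq_rcons xc eq_sym (negbTE ac).
by right; apply: lcs_subseq.
Qed.

End LcsRecursion.

(** * One letter of the dynamics against one row of the LCS table *)

Section Row.
Local Open Scope set_scope.
Local Open Scope nat_scope.
Variables (k : nat) (hk : (0 < k)%N).
Local Notation pad n := (residue hk n).
Local Notation W := (ord_tuple k).

(** Since [e] is at most [k], [a + e] is the first number beyond [a] in its residue class. *)
Lemma congruent_ge a b e : a < b -> 0 < e -> e <= k -> pad (a + e) = pad b -> a + e <= b.
Proof.
move=> ab e0 ek [abe]; rewrite leqNgt; apply/negP => lt.
have /eqP := abe; rewrite eqn_mod_dvd ?(ltnW lt) // => /dvdn_leq.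
by rewrite subn_gt0 lt => /(_ isT); lia.
Qed.

(* Here [P] lifts the positions of the frogs to the line; [gap] is a difference of two
   successive entries of the row of the LCS table. *)
Definition gap (F : positions k) (P : 'I_k -> nat) i : nat :=
  [exists m, (F m == pad i) && (i < P m)].

Definition row F P j := \sum_(i < j) gap F P i.

Lemma rowS F P j : row F P j.+1 = row F P j + gap F P j.
Proof. by rewrite /row big_ord_recr. Qed.

Lemma gapE (F : positions k) P i m : injective F -> F m = pad i -> gap F P i = (i < P m).
Proof.
move=> Finj Fm; rewrite /gap; congr nat_of_bool; apply/existsP/idP => [[n]|lt].
  by rewrite -Fm (inj_eq Finj) => /andP[/eqP ->].
by exists m; rewrite Fm eqxx.
Qed.

Section RowStep.
Variables (F : positions k) (P : 'I_k -> nat) (c : 'I_k).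
Hypotheses (Finj : injective F) (PF : forall m, pad (P m) = F m)
  (Pmono : forall i j : 'I_k, i < j -> P i < P j).

Local Notation level := (level hk F c).
Local Notation jump := (jump hk F c).
Local Notation landed := (landed hk F c).
Let P' m := P m + jump m.

Let jumpE m : jump m = level m.+1 - level m. Proof. by []. Qed.

Lemma level_mono i j : i <= j -> j <= k -> level i <= level j.
Proof.
move=> ij jk; rewrite -(subnKC ij) in jk *; elim: (j - i) jk => [|d IH] jk.
  by rewrite addn0.
rewrite addnS in jk *; apply: leq_trans (IH (ltnW jk)) _.
exact: (level_leS hk c Finj (Ordinal jk)).
Qed.

Lemma hit_between y (q : 'I_k) : level q < y <= level q.+1 -> F q = pad (c + level q).
Proof.
move=> /andP[qy yq]; apply/eqP.
by rewrite -(jump_gt0 hk c Finj) subn_gt0 (leq_trans qy).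
Qed.

(** The leaps caused by one letter tile a full turn starting at [c], because [level] grows from 0 to
    [k]. *)
Lemma between y : 0 < y <= k -> exists q : 'I_k, level q < y <= level q.+1.
Proof.
move=> /andP[y0 yk].
have ex : exists m, y <= level m by exists k; rewrite levelk.
have [m my mmin] := ex_minnP ex.
have mk : m <= k by apply: mmin; rewrite levelk.
case: m => [|m] in my mmin mk *; first by rewrite level0 leqNgt y0 in my.
exists (Ordinal mk); rewrite my andbT ltnNge; apply/negP => /mmin.
by rewrite ltnn.
Qed.

Lemma between_inj y (q q' : 'I_k) :
  level q < y <= level q.+1 -> level q' < y <= level q'.+1 -> q = q'.
Proof.
move=> /andP[a b] /andP[a' b']; apply: val_inj => /=.
case: (ltngtP q q') => // lt.
  by have := level_mono lt (ltnW (ltn_ord q')); rewrite leqNgt (leq_trans a').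
by have := level_mono lt (ltnW (ltn_ord q)); rewrite leqNgt (leq_trans a).
Qed.

(** Frog [i] passes only over pads of nastier frogs, so it cannot pass frog [j]. If it lands exactly
    on the site of [j], then [j] is dislodged and moves ahead. *)
Lemma lifted_mono (i j : 'I_k) : i < j -> P' i < P' j.
Proof.
move=> ij; rewrite /P'; have Pij := Pmono ij.
case: (posnP (jump i)) => [->|]; first by rewrite addn0 ltn_addr.
move=> e0; have /eqP Fi := etrans (esym (jump_gt0 hk c Finj i)) e0.
have jumpiK := jumpK hk c Finj i.
have lev_le : level i.+1 <= k by apply: hop_le.
have j_notin : F j \notin lows F i.+1 by rewrite mem_lows // -leqNgt.
have le_e : P i + jump i <= P j.
  rewrite leqNgt; apply/negP => lt; case/negP: j_notin.
  rewrite -PF (_ : P j = P i + (P j - P i)); last by rewrite subnKC // ltnW.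
  rewrite -residueDl PF Fi residueDl -addnA; apply: (@hop_in k hk).
  by rewrite -/(level i.+1) -jumpiK ltn_add2l; lia.
move: le_e; rewrite leq_eqVlt => /orP[/eqP e|]; last exact: ltn_addr.
rewrite e -[X in X < _]addn0 ltn_add2l jump_gt0 //.
have Fj : F j = pad (c + level i.+1).
  by rewrite -PF -e -residueDl PF {1}Fi residueDl -addnA jumpiK.
rewrite Fj; have [lt|ge] := ltnP (level i.+1) k; last first.
  case/negP: j_notin; rewrite Fj (_ : level i.+1 = k); last by apply/eqP; rewrite eqn_leq lev_le ge.
  rewrite residueDk; rewrite -[c \in _]negbK -(hop_eq0 hk) -/(level i.+1) -jumpiK.
  by rewrite -lt0n addn_gt0 e0 orbT.
suff -> : level j = level i.+1 by [].
have le1 : level i.+1 <= level j by apply: level_mono => //; exact: ltnW.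
apply/eqP; rewrite eqn_leq le1 andbT.
rewrite leqNgt; apply/negP => lt'.
by have := hop_in lt'; rewrite -Fj mem_lows // ltnn.
Qed.

(* The increment of the row is 1 at [j] iff the frog that arrives at the residue of [j] does
   so at a site at most [j]; this gives the recursion of the LCS table site by site. *)
Lemma row_step j :
  (forall y (q : 'I_k), pad j = pad (c + y) -> level q < y <= level q.+1 ->
     row landed P' j = row F P j + (P q + (y - level q) <= j)) /\
  row landed P' j.+1 = if pad j == c then (row F P j).+1
                       else maxn (row landed P' j) (row F P j.+1).
Proof.
have Linj : injective landed by apply: landed_inj.
have lev_le (m : 'I_k) : level m.+1 <= k by apply: hop_le.
pose carry j := forall y (q : 'I_k), pad j = pad (c + y) -> level q < y <= level q.+1 ->
     row landed P' j = row F P j + (P q + (y - level q) <= j).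
(* The carry at one site determines the next carry and the table entry. At site 0 the carry is 0,
   because a frog arrives strictly to the right of where it starts. *)
suff step i : carry i -> carry i.+1 /\
  row landed P' i.+1 = if pad i == c then (row F P i).+1
                       else maxn (row landed P' i) (row F P i.+1).
  have carryP : forall i, carry i.
    elim=> [|i /step[] //] y q _ /andP[qy _].
    by rewrite /row !big_ord0 leqn0 addn_eq0 subn_eq0 leqNgt qy andbF.
  by split; [exact: carryP|exact: (step j (carryP j)).2].
move=> IH; have [y0 y0k yi] := residue_onto hk c (pad i).
(* [y] and [q] at site [i + 1] are determined by those at site [i] *)
have next y (q : 'I_k) : pad i.+1 = pad (c + y) -> level q < y <= level q.+1 -> y = y0.+1.
  move=> yi1 /andP[qy yq]; case: y => // y in yi1 qy yq *.
  have yk : y < k := leq_trans yq (lev_le q).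
  congr _.+1; apply/eqP; rewrite -(residue_inj hk c) // yi; apply/eqP.
  apply: val_inj => /=; move/(congr1 val): yi1 => /= /eqP.
  by rewrite addnS -(addn1 i) -(addn1 (c + y)) eqn_modDr => /eqP.
have [q1 q1P] : exists q : 'I_k, level q < y0.+1 <= level q.+1 by apply: between.
have F1 := hit_between q1P.
suff [vE BE] : row landed P' i.+1 = row F P i.+1 + (P q1 + (y0.+1 - level q1) <= i.+1) /\
   row landed P' i.+1 = if pad i == c then (row F P i).+1
                       else maxn (row landed P' i) (row F P i.+1).
  split=> // y q yi1 yq; have e := next _ _ yi1 yq; rewrite e in yq *.
  by rewrite (between_inj yq q1P).
(* At a site of the poked residue, [q1] is the frog that starts there and [q] the one that closes
   the turn by landing there. *)
have [y00|y0_gt0] := posnP y0.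
  have ci : pad i = c by rewrite -yi y00 residue0.
  have [q qP] : exists q : 'I_k, level q < k <= level q.+1 by apply: between; rewrite hk leqnn.
  have Fq := hit_between qP.
  have lq : level q.+1 = k by apply/eqP; rewrite eqn_leq lev_le; case/andP: qP.
  have l1 : level q1 = 0 by move: q1P; rewrite y00; case: (level q1).
  have g : gap F P i = (i < P q1).
    by apply: gapE => //; rewrite F1 l1 residue0.
  have g' : gap landed P' i = (i < P q + (k - level q)).
    rewrite (@gapE _ _ _ q) //; last by rewrite landed_hit // lq residueDk.
    by rewrite /P' jumpE lq.
  have := IH k q; rewrite residueDk => /(_ ci qP) e.
  rewrite ci eqxx !rowS e g g' l1 y00; split; lia.
have ci : pad i == c = false.
  rewrite -yi -[X in _ == X](residue0 hk) residue_inj //.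
  by rewrite gtn_eqF.
have [q0 q0P] : exists q : 'I_k, level q < y0 <= level q.+1.
  by apply: between; rewrite y0_gt0 ltnW.
have F0 := hit_between q0P.
have e := IH y0 q0 (esym yi) q0P.
rewrite ci !rowS e.
(* Either [q0] lands on the residue of [i] and dislodges [q1], or it passes over it, and the pad is
   kept by a nastier frog [f] that does not move. *)
case/andP: (q0P) => q0y; rewrite leq_eqVlt => /orP[/eqP y0E|yq0].
  have q01 : q0 < q1.
    rewrite ltnNge; apply/negP => le.
    have := @level_mono q1.+1 q0.+1 le (ltn_ord q0).
    by rewrite -y0E leqNgt; case/andP: q1P => _ ->.
  have l1 : level q1 = y0.
    apply/eqP; rewrite eqn_leq; case/andP: q1P => + _; rewrite ltnS => -> /=.
    by rewrite y0E; apply: level_mono => //; exact: ltnW.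
  have g : gap F P i = (i < P q1) by apply: gapE; rewrite // F1 l1.
  have g' : gap landed P' i = (i < P q0 + (y0 - level q0)).
    rewrite (@gapE _ _ _ q0) //; last by rewrite landed_hit // -y0E.
    by rewrite /P' jumpE -y0E.
  have ge : P q0 + (y0 - level q0) <= P q1.
    apply: congruent_ge; first exact: Pmono.
    - by rewrite subn_gt0.
    - by rewrite (leq_trans (leq_subr _ _)) // ltnW.
    rewrite -residueDl PF {1}F0 residueDl -addnA subnKC; last exact: ltnW.
    by rewrite PF F1 l1.
  by rewrite g g' l1; split; lia.
have q10 : q1 = q0.
  apply: between_inj q1P _; rewrite yq0 andbT.
  by rewrite ltnS ltnW.
have [f Ff] : exists f, F f = pad i.
  have : pad i \in lows F k by rewrite lows_full // inE.
  by case/imsetP => f _ ->; exists f.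
have fq : f < q0.
  have : pad i \in lows F q0.+1 by rewrite -yi hop_in.
  rewrite -Ff mem_lows // ltnS leq_eqVlt => /orP[/eqP/val_inj fq|//].
  move: F0; rewrite -fq Ff -yi => /eqP; rewrite residue_inj // => [/eqP|]; last first.
    by apply: leq_trans y0k; rewrite fq ltnS ltnW.
  by rewrite fq => y0E; rewrite y0E ltnn in q0y.
have f_id : F f != pad (c + level f).
  have lf : level f <= level q0 by apply: level_mono (ltnW fq) (ltnW (ltn_ord q0)).
  rewrite Ff -yi residue_inj //; last by apply: leq_ltn_trans lf (ltn_trans q0y _).
  by rewrite gtn_eqF // (leq_ltn_trans lf).
have g : gap F P i = (i < P f) by apply: gapE.
have g' : gap landed P' i = (i < P f).
  rewrite (@gapE _ _ _ f) //; last by rewrite landed_id.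
  by rewrite /P' jumpE level_id // subnn addn0.
have := Pmono fq; rewrite g g' q10; split; lia.
Qed.

End RowStep.
End Row.

(** * LCS lengths in terms of total displacements *)

Section LcsDisplacement.
Local Open Scope nat_scope.
Variables (k : nat) (hk : (0 < k)%N).
Local Notation pad n := (residue hk n).
Local Notation W := (ord_tuple k).
Local Notation act := (act hk W).
Local Notation act_word := (act_word hk W).

Fixpoint disp_sum (m : 'I_k) (F : positions k) (r : seq 'I_k) : nat :=
  if r is c :: r' then displacement hk W m F c + disp_sum m (act F c) r' else 0.

Lemma total_displacementE m n (r : n.-tuple 'I_k) F :
  total_displacement hk W m F r = disp_sum m F r.
Proof.
rewrite /total_displacement; elim: n r F => [|n IH] r F.
  by rewrite big_ord0 tuple0.
rewrite big_ord_recl; case/tupleP: r => c r /=; rewrite -IH; congr (_ + _).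
by apply: eq_bigr => i _; rewrite tnthS.
Qed.

Lemma act_word_rcons F r c : act_word F (rcons r c) = act (act_word F r) c.
Proof. by rewrite /Defs.act_word -cats1 foldl_cat. Qed.

Lemma disp_sum_rcons m F r c :
  disp_sum m F (rcons r c) = disp_sum m F r + displacement hk W m (act_word F r) c.
Proof. by elim: r F => [|d r IH] F /=; rewrite ?addn0 // IH addnA. Qed.

Definition lifted r (m : 'I_k) : nat := m + disp_sum m (id_arrangement k) r.

Definition resting r := act_word (id_arrangement k) r.

Lemma resting_inj r : injective (resting r).
Proof. exact/act_word_inj/id_arrangement_inj. Qed.

Lemma resting_rcons r c : resting (rcons r c) = landed hk (resting r) c.
Proof. by rewrite /resting act_word_rcons actE //; apply: resting_inj. Qed.

Lemma lifted_rcons r c : lifted (rcons r c) =1 fun m => lifted r m + jump hk (resting r) c m.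
Proof.
move=> m; rewrite /lifted disp_sum_rcons addnA displacementE //; exact: resting_inj.
Qed.

Lemma lifted_residue r m : pad (lifted r m) = resting r m.
Proof.
elim/last_ind: r => [|r c IH].
  by rewrite /lifted addn0 residue_ord ffunE.
by rewrite lifted_rcons -residueDl IH resting_rcons ffunE.
Qed.

Lemma lifted_lt r (i j : 'I_k) : i < j -> lifted r i < lifted r j.
Proof.
elim/last_ind: r i j => [|r c IH] i j ij; first by rewrite /lifted !addn0.
rewrite !lifted_rcons; apply: lifted_mono ij => //; last exact: lifted_residue.
exact: resting_inj.
Qed.

Definition periodic j : seq 'I_k := [seq pad i | i <- iota 0 j].

Lemma periodicS j : periodic j.+1 = rcons (periodic j) (pad j).
Proof. by rewrite /periodic -addn1 iotaD map_cat cats1. Qed.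

Lemma periodic_wordE n : periodic_word hk W n = periodic n :> seq 'I_k.
Proof.
rewrite /periodic -val_enum_ord -map_comp /=.
by apply: eq_map => i /=; rewrite tnth_ord_tuple.
Qed.

Lemma eq_row F P P' j : P =1 P' -> row hk F P j = row hk F P' j.
Proof.
move=> PP'; apply: eq_bigr => i _; congr nat_of_bool.
by apply: eq_existsb => m; rewrite PP'.
Qed.

(** Both sides vanish on the boundary of the table and obey the same recursion: that of the last
    letters for [lcs], and [row_step] for [row]. *)
Theorem lcs_row r j : lcs r (periodic j) = row hk (resting r) (lifted r) j.
Proof.
elim/last_ind: r j => [|r c IH] j.
  (* Initially the frog on the residue of [i] stands at site [i %% k], which is not beyond [i]. *)
  rewrite lcs_nill /row big1 // => i _; rewrite /gap; case: existsP => // -[m].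
  rewrite ffunE /lifted addn0 => /andP[/eqP ->] /=.
  by rewrite ltnNge leq_mod.
rewrite resting_rcons (eq_row _ _ (lifted_rcons r c)).
elim: j => [|j IHj]; first by rewrite lcs_nilr /row big_ord0.
have [_ ->] := row_step c (@resting_inj r) (lifted_residue r) (@lifted_lt r) j.
rewrite -IHj -!IH periodicS; case: eqVneq => [->|jc].
  by rewrite lcs_rcons_eq.
by rewrite lcs_rcons_neq.
Qed.

Lemma count_residue (x : 'I_k) n : \sum_(i < n) (pad i == x) = n %/ k + (x < n %% k).
Proof.
elim: n => [|n IH]; first by rewrite big_ord0 div0n mod0n.
rewrite big_ord_recr /= IH divnS // modnS -val_eqE /=.
have xk := ltn_ord x; have nk := ltn_pmod n hk.
case: ifP => kn.
  have e : n %% k = k.-1.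
    have : (n %% k).+1 = 0 %[mod k] by rewrite -addn1 modnDml addn1 mod0n; apply/eqP.
    rewrite mod0n; case: (ltngtP (n %% k).+1 k) nk => // [lt|e _ _]; last lia.
    by rewrite modn_small.
  rewrite e ltn0 addn0; case: eqP => e'; case: ltnP => /= h; lia.
by case: eqP => e'; case: ltnP => h; case: ltnP => h'; lia.
Qed.

Lemma row_count (F : positions k) (P : 'I_k -> nat) n :
  injective F -> (forall m, pad (P m) = F m) ->
  row hk F P n = \sum_m \sum_(i < minn n (P m)) (pad i == F m).
Proof.
move=> Finj PF; rewrite /row.
transitivity (\sum_(i < n) \sum_m ((F m == pad i) && (i < P m))).
  apply: eq_bigr => i _; rewrite /gap; case: existsP => [[m /andP[/eqP Fm im]]|nex].
    rewrite (bigD1 m) //= Fm eqxx im big1 // => m' m'm.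
    by rewrite -Fm (inj_eq Finj) (negbTE m'm).
  by rewrite big1 // => m _; apply/eqP; rewrite eqb0; apply/negP => h; apply: nex; exists m.
rewrite exchange_big /=; apply: eq_bigr => m _.
rewrite (big_ord_widen n (fun i => (pad i == F m) : nat)) ?geq_minl //.
rewrite big_mkcond [RHS]big_mkcond; apply: eq_bigr => i _ /=.
rewrite leq_min ltn_ord /= eq_sym.
by case: (i < P m); rewrite ?andbT ?andbF.
Qed.

(** Each frog contributes the sites of one residue class below [minn n (lifted r m)], a fraction
    [1 / k] of them up to one site. Multiplied by [k], rounding and the initial offset [m] cost at
    most [2 * k] per frog. *)
Lemma lcs_displacement n r :
  k * lcs r (periodic n) <= \sum_m minn n (disp_sum m (id_arrangement k) r) + 2 * k * k /\
  \sum_m minn n (disp_sum m (id_arrangement k) r) <= k * lcs r (periodic n) + 2 * k * k.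
Proof.
rewrite lcs_row (row_count _ (@resting_inj r) (lifted_residue r)) big_distrr /=.
have kk : 2 * k * k = \sum_(m < k) (2 * k) by rewrite sum_nat_const card_ord mulnC.
rewrite kk -!big_split /=.
suff bound m : k * (\sum_(i < minn n (lifted r m)) (pad i == resting r m)) <=
    minn n (disp_sum m (id_arrangement k) r) + 2 * k /\
    minn n (disp_sum m (id_arrangement k) r) <=
    k * (\sum_(i < minn n (lifted r m)) (pad i == resting r m)) + 2 * k.
  by split; apply: leq_sum => m _; have [] := bound m.
rewrite count_residue; set N := minn n (lifted r m); set d := minn n (disp_sum m _ r).
have dN : d <= N by rewrite leq_min geq_minl /= (leq_trans (geq_minr _ _)) // leq_addl.
have Nd : N <= d + k.
  rewrite /N /d /lifted; move: (disp_sum m _ r) (ltn_ord m) => e mk; lia.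
have := divn_eq N k; have := ltn_pmod N hk; rewrite mulnDr [k * (N %/ k)]mulnC.
move: (N %/ k * k) (N %% k) => q s sk Nq.
have : k * (resting r m < s) <= k by case: (_ < s); rewrite ?muln1 ?muln0.
by move=> h; split; lia.
Qed.

End LcsDisplacement.

(** * Speeds *)

Section Speeds.
Local Open Scope set_scope.
Local Open Scope ring_scope.
Variables (R : realType) (k : nat) (hk : (0 < k)%N).
Local Notation pad n := (residue hk n).
Local Notation W := (ord_tuple k).

Let card_pads : (0 < #|'I_k|)%N. Proof. by rewrite card_ord. Qed.

(** The mean of [hop] over the [m]-subsets, a quotient of two binomial coefficients. *)
Definition speed_sum (m : nat) : R := m%:R / (k%:R + 1 - m%:R).

Definition speed (m : nat) : R := (k%:R + 1) / ((k%:R + 2 - m.+1%:R) * (k%:R + 1 - m.+1%:R)).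

Lemma speedE m : (m < k)%N -> speed m = speed_sum m.+1 - speed_sum m.
Proof.
move=> mk; rewrite /speed /speed_sum -[m.+1%:R]natr1.
have : (m%:R + 1 : R) <= k%:R by rewrite natr1 ler_nat.
move=> le; field; rewrite !lt0r_neq0 //; lra.
Qed.

Lemma speed_gt0 m : (m < k)%N -> 0 < speed m.
Proof.
move=> mk; have : (m%:R + 1 : R) <= k%:R by rewrite natr1 ler_nat.
move=> le; have k0 : (0 : R) <= k%:R by [].
by rewrite /speed -[m.+1%:R]natr1 divr_gt0 ?mulr_gt0 //; lra.
Qed.

Section SubsetChain.
Variable m : nat.
Hypothesis mk : (m <= k)%N.

Let base := lows (id_arrangement k) m.
(* Sets of the wrong size are sent to a fixed one, which makes the chain irreducible. *)
Let step (A : {set 'I_k}) c := if #|A| == m then set_act hk A c else base.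

Let step_word (A : {set 'I_k}) w : #|A| = m -> foldl step A w = foldl (set_act hk) A w.
Proof.
elim: w A => //= c w IH A Am; rewrite /step Am eqxx IH // card_set_act //.
Qed.

Let step_reach (A : {set 'I_k}) : exists w, foldl step A w = base.
Proof.
have [Am|Am] := eqVneq #|A| m.
  have [w wP] := set_act_reach hk A; exists w.
  by rewrite step_word // wP Am.
by exists [:: Ordinal hk]; rewrite /= /step (negbTE Am).
Qed.

(** The constant is identified by summing the Poisson equation over all [m]-subsets: by
    [sum_set_act] the terms in [h] cancel, and [sum_hop] gives the rest. *)
Lemma hop_poisson : exists h : {set 'I_k} -> R, forall A : {set 'I_k}, #|A| = m ->
  avg (fun c => (hop hk A c)%:R) = speed_sum m + h A - avg (fun c => h (set_act hk A c)).
Proof.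
have [gbar [h hP]] := poisson card_pads step_reach (fun A => avg (fun c => (hop hk A c)%:R : R)).
have {}hP (A : {set 'I_k}) : #|A| = m ->
    avg (fun c => (hop hk A c)%:R) = gbar + h A - avg (fun c => h (set_act hk A c)).
  by move=> Am; rewrite hP /markov /step Am eqxx.
exists h; suff -> : speed_sum m = gbar by [].
have k0 : k%:R != 0 :> R by rewrite pnatr_eq0 -lt0n.
have sum_h : \sum_(A : {set 'I_k} | #|A| == m) avg (fun c => h (set_act hk A c)) =
    \sum_(A : {set 'I_k} | #|A| == m) h A.
  by rewrite -mulr_suml (sum_set_act hk) card_ord -[X in X / _]mulr_natr mulfK.
have sum_g : \sum_(A : {set 'I_k} | #|A| == m) avg (fun c => (hop hk A c)%:R : R) =
    'C(k, (k - m).+1)%:R.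
  rewrite -mulr_suml exchange_big /= (eq_bigr (fun=> 'C(k, (k - m).+1)%:R)); last first.
    by move=> c _; rewrite -natr_sum sum_hop.
  by rewrite sumr_const !card_ord -[X in X / _]mulr_natr mulfK.
have : \sum_(A : {set 'I_k} | #|A| == m) avg (fun c => (hop hk A c)%:R : R) =
    'C(k, k - m)%:R * gbar.
  rewrite (eq_bigr (fun A => gbar + h A - avg (fun c => h (set_act hk A c)))); last first.
    by move=> A /eqP; apply: hP.
  rewrite big_split /= sumrN sum_h big_split /= addrK sumr_const.
  rewrite -[LHS]mulr_natl; congr (_%:R * _).
  have := card_superset hk (@finset.set0 'I_k) mk; rewrite cards0 subn0 => <-.
  by apply: eq_card => A; rewrite [in RHS]inE finset.sub0set.
rewrite sum_g => binE.
have bin0 : 'C(k, k - m)%:R != 0 :> R by rewrite pnatr_eq0 -lt0n bin_gt0 leq_subr.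
have d0 : 0 < k%:R + 1 - m%:R :> R.
  have : (m%:R : R) <= k%:R by rewrite ler_nat.
  lra.
apply: (mulfI bin0); rewrite -binE /speed_sum mulrA; apply: (canLR (mulfK (lt0r_neq0 d0))).
have := mul_bin_left k (k - m); rewrite subKn // => /(congr1 (fun n => n%:R : R)).
rewrite !natrM -natr1 natrB // => e; rewrite -[LHS]mulrC -e; ring.
Qed.

End SubsetChain.
End Speeds.

(** * Moments of the displacement of a single frog *)

Section ArrangementChain.
Local Open Scope set_scope.
Local Open Scope ring_scope.
Variables (R : realType) (k : nat) (hk : (0 < k)%N).
Local Notation pad n := (residue hk n).
Local Notation W := (ord_tuple k).

Let card_pads : (0 < #|'I_k|)%N. Proof. by rewrite card_ord. Qed.

(** The state space is cut down to injective position maps, from each of which [id_arrangement] is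
    reachable. *)
Definition arrangement := {F : {ffun 'I_k -> 'I_k} | injectiveb F}.

Lemma arrangement_inj (F : arrangement) : injective (val F).
Proof. exact/injectiveP/(valP F). Qed.

Lemma act_injectiveb (F : arrangement) c : injectiveb (act hk W (val F) c).
Proof. exact/injectiveP/act_inj/arrangement_inj. Qed.

Definition arr_step (F : arrangement) c : arrangement :=
  exist (fun G : {ffun 'I_k -> 'I_k} => injectiveb G) _ (act_injectiveb F c).

Definition arr (F : positions k) (Finj : injective F) : arrangement :=
  exist (fun G : {ffun 'I_k -> 'I_k} => injectiveb G) F (introT (injectiveP _) Finj).

Definition displacementR (m : 'I_k) (F : arrangement) c : R :=
  (displacement hk W m (val F) c)%:R.

Lemma path_sum_displacement m F r :
  path_sum arr_step (displacementR m) F r = (disp_sum hk m (val F) r)%:R.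
Proof.
by elim: r F => //= c r IH F; rewrite IH natrD.
Qed.

Lemma arr_reach (F : arrangement) :
  exists w, foldl arr_step F w = arr (@id_arrangement_inj k).
Proof.
have [w wP] := reach_id hk (@arrangement_inj F); exists w; apply: val_inj; rewrite /= -wP.
by elim: w F {wP} => //= c w IH F; rewrite IH.
Qed.

(** The displacement is the difference of the hops of two nested sets, hence a solution is the
    difference of theirs. *)
Lemma displacement_poisson (m : 'I_k) : exists h : arrangement -> R, forall F,
  avg (displacementR m F) = speed R k m + h F - markov arr_step h F.
Proof.
have [h1 h1P] := hop_poisson R hk (ltn_ord m).
have [h0 h0P] := hop_poisson R hk (ltnW (ltn_ord m)).
exists (fun F => h1 (lows (val F) m.+1) - h0 (lows (val F) m)) => F.
have Finj := @arrangement_inj F.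
rewrite /markov avgB.
have lE n : (n <= k)%N -> forall h : {set 'I_k} -> R,
    avg (fun c => h (lows (val (arr_step F c)) n)) =
    avg (fun c => h (set_act hk (lows (val F) n) c)).
  by move=> nk h; apply: eq_avg => c; rewrite /= lows_act.
rewrite !lE // 1?ltnW //.
have := h1P (lows (val F) m.+1) (card_lows Finj (ltn_ord m)).
have := h0P (lows (val F) m) (card_lows Finj (ltnW (ltn_ord m))).
have -> : avg (displacementR m F) =
    avg (fun c => (hop hk (lows (val F) m.+1) c)%:R) -
    avg (fun c => (hop hk (lows (val F) m) c)%:R).
  rewrite -avgB; apply: eq_avg => c; rewrite /displacementR displacementE // natrB //.
  exact: level_leS.
by rewrite speedE ?ltn_ord // => -> ->; ring.
Qed.

Lemma expect_displacement (m : 'I_k) n (F : positions k) (Finj : injective F) :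
  expect_word R (@total_displacement _ k hk W m n F) =
  avgn n (path_sum arr_step (displacementR m) (arr Finj)).
Proof.
rewrite (expect_wordE R (Y := disp_sum hk m F)); last by move=> r; rewrite total_displacementE.
by apply: eq_avgn => r _; rewrite path_sum_displacement.
Qed.

Lemma mean_displacement (m : 'I_k) : exists K, forall n (F : arrangement),
  `|avgn n (path_sum arr_step (displacementR m) F) - speed R k m * n%:R| <= K.
Proof.
have [h hP] := displacement_poisson m.
exact: (mean_path_sum card_pads hP).
Qed.

Let last_lt : (k.-1 < k)%N. Proof. by rewrite ltn_predL. Qed.

(* Poking the least nasty frog makes it go once around the circle and come back. *)
Lemma poke_last (F : arrangement) (l := Ordinal last_lt) (c := val F l) :
  arr_step F c = F /\
  forall m : 'I_k, displacement hk W m (val F) c = if m == l then k else 0%N.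
Proof.
have Finj := @arrangement_inj F.
have lev0 i : (i <= k.-1)%N -> level hk (val F) c i = 0%N.
  by move=> ik; apply/eqP; rewrite hop_eq0 mem_lows // -leqNgt.
have levk : level hk (val F) c k = k by rewrite levelk.
have jumpE (m : 'I_k) : jump hk (val F) c m = if m == l then k else 0%N.
  rewrite /jump; case: eqVneq => [->|ml].
    by rewrite /= prednK // levk lev0 // subn0.
  have mk : (m < k.-1)%N.
    by rewrite ltn_neqAle -ltnS prednK // ltn_ord andbT; exact: ml.
  by rewrite !lev0 // ltnW.
split; last by move=> m; rewrite displacementE.
apply: val_inj => /=; rewrite actE //; apply/ffunP => m.
rewrite ffunE jumpE; case: eqP => [->|_]; first by rewrite residueDk.
by rewrite addn0 residue_ord.
Qed.

(** On the loop of [poke_last] the corrector cancels. The increment is then minus a positive speed,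
    or [k - (k + 1) / 2] for the last frog, which is nonzero for [k > 1]. *)
Lemma displacement_nondegenerate (m : 'I_k) (h : arrangement -> R) F : (1 < k)%N ->
  exists c, displacementR m F c + h (arr_step F c) - h F - speed R k m != 0.
Proof.
move=> k1; have [stepE dispE] := poke_last F.
exists (val F (Ordinal last_lt)).
rewrite stepE /displacementR dispE addrK.
have s0 := speed_gt0 R (ltn_ord m).
case: (eqVneq m (Ordinal last_lt)) => [->|_]; last by rewrite sub0r oppr_eq0 gt_eqF.
rewrite subr_eq0 /speed /= prednK //.
have k2 : (2 : R) <= k%:R by rewrite ler_nat.
apply/negP => /eqP; rewrite (_ : _ / _ = (k%:R + 1) / 2); last first.
  by congr (_ / _); ring.
lra.
Qed.

Lemma abs_displacement (m : 'I_k) : exists c : R, [/\ 0 <= c,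
  (1 < k)%N -> (c != 0) = (speed R k m == 1) &
  exists K, forall n F, `|avgn n (fun r => `|(disp_sum hk m (val (F : arrangement)) r)%:R - n%:R|)
    - (`|speed R k m - 1| * n%:R + c * Num.sqrt n%:R)| <= K].
Proof.
case: (ltngtP k 1%N) => [|k1|kE]; first by rewrite ltnNge hk.
  have [h hP] := displacement_poisson m.
  have [theta th0 absP] := abs_path_sum card_pads hP arr_reach
     (fun F => displacement_nondegenerate m h F k1).
  exists (if speed R k m == 1 then theta else 0); split.
  - by case: ifP => // _; apply: ltW.
  - by move=> _; case: (_ == 1); rewrite ?eqxx // gt_eqF.
  have [K KP] := absP 1; exists K => n F.
  have := KP n F; congr (`|_ - _| <= _); apply: eq_avgn => r _.
  by rewrite path_sum_displacement mul1r.
(* For [k = 1] the only frog moves by exactly 1 at each letter, so there is no fluctuation. *)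
exists 0; split=> //; exists 0 => n F.
have disp1 (G : positions k) r : injective G -> disp_sum hk m G r = size r.
  elim: r G => //= c r IH G Ginj; rewrite IH; last exact: act_inj.
  rewrite displacementE // /jump.
  have m0 : m = 0%N :> nat by have := ltn_ord m; lia.
  rewrite (_ : m.+1 = k); last by lia.
  by rewrite levelk // m0 level0; lia.
rewrite (eq_avgn (Y := fun=> 0)); last first.
  by move=> r rn; rewrite disp1 ?rn ?subrr ?normr0 //; exact: arrangement_inj.
rewrite avgn_cst // mul0r addr0 sub0r normrN.
have -> : speed R k m = 1.
  have m0 : m = 0%N :> nat by have := ltn_ord m; lia.
  by rewrite /speed m0 kE; field.
by rewrite subrr normr0 mul0r normr0.
Qed.

End ArrangementChain.

(** * Asymptotics *)

Section Asymptotics.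
Local Open Scope ring_scope.
Variable R : realType.

Lemma cvg_of_bounded_error (u : nat -> R) s K :
  (forall n, `|u n - s * n%:R| <= K) -> (u n / n%:R @[n --> \oo] --> s)%classic.
Proof.
move=> uK; apply/cvgrPdist_le => e e0.
near=> n.
have n0 : 0 < n%:R :> R by near: n; exact: nbhs_infty_gtr.
have -> : s - u n / n%:R = - (u n - s * n%:R) / n%:R by field; exact: lt0r_neq0.
rewrite mulNr normrN normrM [`|_^-1|]ger0_norm ?invr_ge0 ?(ltW n0) //.
rewrite ler_pdivrMr //; apply: le_trans (uK n) _.
by rewrite mulrC -ler_pdivrMr //; near: n; exact: nbhs_infty_ger.
Unshelve. all: by end_near. Qed.

Lemma lcs_asymptoticsP (k : nat) (hk : (0 < k)%N) (gamma tau : R) :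
  lcs_asymptotics hk (ord_tuple k) gamma tau <->
  exists K N, forall n, (N <= n)%N ->
    `|avgn n (fun r => (lcs r (periodic hk n))%:R) - (gamma * n%:R - tau * Num.sqrt n%:R)| <= K.
Proof.
have E n : expect_word R (fun r : n.-tuple 'I_k => lcs r (periodic_word hk (ord_tuple k) n)) =
    avgn n (fun r => (lcs r (periodic hk n))%:R).
  by apply: expect_wordE => r; rewrite periodic_wordE.
rewrite /lcs_asymptotics; split.
  move/eqO_exP => [K _ [N _ NK]]; exists K, N => n /NK /=.
  by rewrite normr1 mulr1 E.
move=> [K [N KN]]; apply/eqO_exP; exists (`|K| + 1) => /=.
  by rewrite ltr_pwDr.
exists N => // n /= /KN; rewrite normr1 mulr1 E => /le_trans; apply.
by apply: le_trans (ler_norm K) _; rewrite lerDl.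
Qed.

(** Along squares [n = j * j] the expression becomes the polynomial [a * j ^+ 2 - b * j]. *)
Lemma bounded_sqrt_eq0 (a b K : R) N :
  (forall n, (N <= n)%N -> `|a * n%:R - b * Num.sqrt n%:R| <= K) -> a = 0 /\ b = 0.
Proof.
move=> abK.
have sq j : (N <= j)%N -> (0 < j)%N -> `|a * j%:R - b| * j%:R <= K.
  move=> Nj j0; have Njj : (N <= j * j)%N by rewrite (leq_trans Nj) // leq_pmull.
  have := abK _ Njj; rewrite natrM -expr2 sqrtr_sqr (ger0_norm (ler0n R j)).
  have -> : a * j%:R ^+ 2 - b * j%:R = (a * j%:R - b) * j%:R by ring.
  by rewrite normrM (ger0_norm (ler0n R j)).
have linear_bound (x c : R) : (forall j, (N <= j)%N -> (0 < j)%N -> `|x| * j%:R <= c) -> x = 0.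
  move=> xc; apply/eqP; apply: contraT => x0; have xp : 0 < `|x| by rewrite normr_gt0.
  have [N0 _ N0P] := nbhs_infty_gtr (c / `|x|); pose j := maxn N.+1 N0.
  have Nj : (N.+1 <= j)%N by rewrite leq_maxl.
  have := xc j (ltnW Nj) (leq_ltn_trans (leq0n _) Nj).
  rewrite mulrC -ler_pdivlMr // leNgt.
  have -> // : c / `|x| < j%:R.
  by apply: N0P; rewrite /= leq_maxr.
have a0 : a = 0.
  apply: (linear_bound a (K + `|b|)) => j Nj j0.
  have j1 : 1 <= j%:R :> R by rewrite ler1n.
  have h : `|a * j%:R - b| <= K.
    by apply: le_trans (sq j Nj j0); apply: ler_peMr.
  rewrite -(ger0_norm (ler0n R j)) -normrM -[a * _](subrK b).
  by apply: le_trans (ler_normD _ _) _; rewrite lerD2r.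
split=> //; apply: (linear_bound b K) => j Nj j0.
by have := sq j Nj j0; rewrite a0 mul0r sub0r normrN.
Qed.

Lemma minn_real (a b : nat) : (minn a b)%:R = (a%:R + b%:R - `|b%:R - a%:R|) / 2 :> R.
Proof.
case: (leqP a b) => ab.
  have : (a%:R : R) <= b%:R by rewrite ler_nat.
  by move=> abR; rewrite ger0_norm ?subr_ge0 //; field.
have : (b%:R : R) <= a%:R by rewrite ler_nat ltnW.
by move=> abR; rewrite distrC ger0_norm ?subr_ge0 //; field.
Qed.

Section LcsAsymptotics.
Variables (k : nat) (hk : (0 < k)%N).

Let s m := speed R k m.

(** Each summand is the minimum of 1 and [s m], in the form produced by [minn_real]. *)
Definition gamma0 : R := (\sum_(m < k) (1 + s m - `|s m - 1|) / 2) / k%:R.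

Lemma lcs_expansion : exists c : 'I_k -> R,
  (forall m, 0 <= c m /\ ((1 < k)%N -> (c m != 0) = (s m == 1))) /\
  lcs_asymptotics hk (ord_tuple k) gamma0 ((\sum_m c m / 2) / k%:R).
Proof.
have card_pads : (0 < #|'I_k|)%N by rewrite card_ord.
have [c cP] := choice (abs_displacement R hk).
exists c; split=> [m|]; first by have [c0 c1 _] := cP m.
have k0 : 0 < k%:R :> R by rewrite ltr0n.
pose F0 := arr (@id_arrangement_inj k).
pose D m r : R := (disp_sum hk m (id_arrangement k) r)%:R.
have [B BP] : exists B : 'I_k -> R, forall m n,
    `|avgn n (fun r => (minn n (disp_sum hk m (id_arrangement k) r))%:R)
      - ((1 + s m - `|s m - 1|) / 2 * n%:R - c m / 2 * Num.sqrt n%:R)| <= B m.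
  suff /choice[B BP] : forall m, exists B, forall n,
      `|avgn n (fun r => (minn n (disp_sum hk m (id_arrangement k) r))%:R)
      - ((1 + s m - `|s m - 1|) / 2 * n%:R - c m / 2 * Num.sqrt n%:R)| <= B by exists B.
  move=> m; have [_ _ [K KP]] := cP m; have [M MP] := mean_displacement R hk m.
  exists ((M + K) / 2) => n.
  have := KP n F0; have := MP n F0.
  rewrite (eq_avgn (Y := D m)); last by move=> r _; rewrite path_sum_displacement.
  have -> : avgn n (fun r => (minn n (disp_sum hk m (id_arrangement k) r))%:R) =
      (n%:R + avgn n (D m) - avgn n (fun r => `|D m r - n%:R|)) / 2.
    rewrite (eq_avgn (Y := fun r => 2^-1 * (n%:R + D m r - `|D m r - n%:R|))); last first.
      by move=> r _; rewrite minn_real mulrC.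
    by rewrite avgnM avgnB avgnD (avgn_cst card_pads) mulrC.
  rewrite /= -/(D m); move: (avgn n (D m)) (avgn n _) => u v.
  rewrite -/(s m) !ler_norml => /andP[u1 u2] /andP[v1 v2].
  by apply/andP; split; lra.
apply/lcs_asymptoticsP; exists ((\sum_m B m + 2 * k%:R * k%:R) / k%:R), 0%N => n _.
pose S r : R := \sum_m (minn n (disp_sum hk m (id_arrangement k) r))%:R.
have h1 : `|k%:R * avgn n (fun r => (lcs r (periodic hk n))%:R) - avgn n S| <= 2 * k%:R * k%:R.
  rewrite -avgnM; apply: avgn_close => // r _.
  have [l1 l2] := lcs_displacement hk n r.
  move: l1 l2; rewrite -!(ler_nat R) !natrD !natrM !natr_sum -/(S r).
  by move=> l1 l2; rewrite ler_norml; apply/andP; split; lra.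
have h2 : `|avgn n S - \sum_(m < k) ((1 + s m - `|s m - 1|) / 2 * n%:R - c m / 2 * Num.sqrt n%:R)|
    <= \sum_m B m.
  rewrite avgn_sum -sumrB; apply: le_trans (ler_norm_sum _ _ _) _.
  by apply: ler_sum => m _; apply: BP.
rewrite ler_pdivlMr // -[X in _ * X <= _](gtr0_norm k0) -normrM.
have -> : (avgn n (fun r => (lcs r (periodic hk n))%:R) -
    (gamma0 * n%:R - (\sum_m c m / 2) / k%:R * Num.sqrt n%:R)) * k%:R =
  (k%:R * avgn n (fun r => (lcs r (periodic hk n))%:R) - avgn n S) +
  (avgn n S - \sum_(m < k) ((1 + s m - `|s m - 1|) / 2 * n%:R - c m / 2 * Num.sqrt n%:R)).
  rewrite /gamma0 sumrB -!mulr_suml; field; exact: lt0r_neq0.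
rewrite [leRHS]addrC; apply: le_trans (ler_normD _ _) _.
exact: lerD.
Qed.

Lemma lcs_asymptotics_unique (g t g' t' : R) :
  lcs_asymptotics hk (ord_tuple k) g t -> lcs_asymptotics hk (ord_tuple k) g' t' ->
  g = g' /\ t = t'.
Proof.
move=> /lcs_asymptoticsP[K [N KN]] /lcs_asymptoticsP[K' [N' KN']].
have [|/eqP + /eqP] := @bounded_sqrt_eq0 (g - g') (t - t') (K + K') (maxn N N').
  move=> n; rewrite geq_max => /andP[/KN h1 /KN' h2].
  move: h1 h2; move: (avgn _ _) (Num.sqrt _) => u w.
  rewrite !ler_norml => /andP[a b] /andP[a' b'].
  by apply/andP; split; lra.
by rewrite !subr_eq0 => /eqP -> /eqP ->.
Qed.

End LcsAsymptotics.

(** * The leading constant as a minimum, and the speeds equal to 1 *)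

Section Gamma.
Variable k : nat.
Hypothesis hk : (0 < k)%N.

Let s m := speed R k m.
Let low m := (1 + s m - `|s m - 1|) / 2.

Let low_le1 m : low m <= 1.
Proof. by rewrite /low; case: (ger0P (s m - 1)) => h; lra. Qed.

Let low_le m : low m <= s m.
Proof. by rewrite /low; case: (ger0P (s m - 1)) => h; lra. Qed.

Let lowl m : s m <= 1 -> low m = s m.
Proof. by move=> h; rewrite /low ler0_norm; lra. Qed.

Let lowr m : 1 <= s m -> low m = 1.
Proof. by move=> h; rewrite /low ger0_norm; lra. Qed.

Let kR : 0 < k%:R :> R. Proof. by rewrite ltr0n. Qed.

Lemma sum_speed t : (t <= k)%N ->
  \sum_(0 <= m < k - t) s m + \sum_(k - t <= m < k) 1 = (k%:R + t%:R ^+ 2) / (t%:R + 1).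
Proof.
move=> tk; have -> : \sum_(0 <= m < k - t) s m = speed_sum R k (k - t).
  rewrite (eq_big_nat _ _ (F2 := fun m => speed_sum R k m.+1 - speed_sum R k m)); last first.
    by move=> m /andP[_ mk]; rewrite /s speedE // (leq_trans mk) // leq_subr.
  by rewrite telescope_sumr // {2}/speed_sum mul0r subr0.
rewrite sumr_const_nat subKn // /speed_sum natrB //.
have : 0 <= t%:R :> R by [].
by move=> t0; field; rewrite !lt0r_neq0 //; lra.
Qed.

Lemma gamma0_split t : (t <= k)%N ->
  gamma0 k = (\sum_(0 <= m < k - t) low m + \sum_(k - t <= m < k) low m) / k%:R.
Proof.
by move=> tk; rewrite /gamma0 -(big_mkord xpredT low) (big_cat_nat (n := k - t)) ?leq_subr.
Qed.

Lemma formulaE t : (k%:R + t%:R ^+ 2) / (k%:R * (t%:R + 1)) =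
  (k%:R + t%:R ^+ 2) / (t%:R + 1) / k%:R :> R.
Proof.
have t0 : 0 <= t%:R :> R by [].
by field; rewrite !lt0r_neq0 //; lra.
Qed.

(** The minimum of 1 and [s m] is bounded by 1 for the [t] last frogs and by [s m] for the others;
    [sum_speed] evaluates the result. For [t > k] the right-hand side is at least 1. *)
Lemma gamma0_le t : gamma0 k <= (k%:R + t%:R ^+ 2) / (k%:R * (t%:R + 1)).
Proof.
rewrite formulaE; have [tk|kt] := leqP t k.
  rewrite (gamma0_split tk) ler_pM2r ?invr_gt0 // -sum_speed //.
  by apply: lerD; apply: ler_sum => m _; [exact: low_le|exact: low_le1].
have t0 : 0 <= t%:R :> R by [].
apply: (@le_trans _ _ (k%:R / k%:R)).
  rewrite /gamma0 ler_pM2r ?invr_gt0 //.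
  apply: (@le_trans _ _ (\sum_(m < k) 1)); first by apply: ler_sum => m _; apply: low_le1.
  by rewrite sumr_const card_ord.
rewrite ler_pM2r ?invr_gt0 // ler_pdivlMr; last lra.
have : k%:R <= t%:R :> R by rewrite ler_nat ltnW.
nra.
Qed.

Lemma speed_ge1 m : (m < k)%N -> (1 <= s m) = ((k - m) * (k - m).+1 <= k.+1)%N.
Proof.
move=> mk; rewrite /s /speed -(ler_nat R) natrM -!natr1 natrB 1?ltnW //.
have : m%:R + 1 <= k%:R :> R by rewrite natr1 ler_nat.
move=> mkR; rewrite ler_pdivlMr; last by rewrite mulr_gt0; lra.
by rewrite mul1r; congr (_ <= _); ring.
Qed.

Lemma speed_eq1 m : (m < k)%N -> (s m == 1) = ((k - m) * (k - m).+1 == k.+1)%N.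
Proof.
move=> mk; rewrite /s /speed -(eqr_nat R) natrM -!natr1 natrB 1?ltnW //.
have : m%:R + 1 <= k%:R :> R by rewrite natr1 ler_nat.
move=> mkR; set q := (X in _ / X).
have q0 : q != 0 by rewrite mulf_neq0 // lt0r_neq0 //; lra.
transitivity (q == k%:R + 1); last by congr (_ == _); rewrite /q; ring.
by apply/eqP/eqP => [h|->]; [rewrite -[RHS](divfK q0) h mul1r|rewrite divff].
Qed.

(** By [speed_ge1], the largest [t] with [t * (t + 1) <= k + 1] is the number of frogs of speed at
    least 1, and for it the bounds in [gamma0_le] are equalities. *)
Lemma gamma0_attained : exists2 t, (0 < t)%N &
  gamma0 k = (k%:R + t%:R ^+ 2) / (k%:R * (t%:R + 1)).
Proof.
pose P t := (t * t.+1 <= k.+1)%N.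
have P1 : P 1%N by rewrite /P mul1n ltnS.
have bound t : P t -> (t <= k)%N.
  by rewrite /P; case: t => // t; rewrite mulSn; nia.
have [t Pt tmax] := ex_maxnP (ex_intro _ 1%N P1) bound.
have t0 : (0 < t)%N by apply: tmax.
exists t => //; have tk := bound t Pt.
rewrite formulaE (gamma0_split tk) -sum_speed //; congr ((_ + _) / _).
  apply: eq_big_nat => m /andP[_ mk]; apply: lowl.
  have mk' : (m < k)%N by rewrite (leq_trans mk) // leq_subr.
  rewrite leNgt; apply/negP => /ltW; rewrite speed_ge1 // => /tmax.
  by lia.
apply: eq_big_nat => m /andP[mk mk']; apply: lowr; rewrite speed_ge1 //.
have : (k - m <= t)%N by lia.
by move: Pt; rewrite /P; nia.
Qed.

Lemma exists_speed_eq1 :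
  (exists m : 'I_k, s m == 1) <-> exists2 r, (0 < r)%N & k = (r ^ 2 + r - 1)%N.
Proof.
split=> [[m]|[r r0 kE]].
  rewrite speed_eq1 // => /eqP e; exists (k - m)%N; first by rewrite subn_gt0.
  have := ltn_ord m; rewrite expnS expn1; move: e; move: (k - m)%N => u; lia.
have rk : (k - r < k)%N by rewrite ltn_subrL r0.
exists (Ordinal rk); rewrite speed_eq1 //=.
have rk' : (r <= k)%N by rewrite kE expnS expn1; nia.
rewrite subKn // kE expnS expn1; apply/eqP; nia.
Qed.

End Gamma.
End Asymptotics.

Theorem theorem3 (R : realType) (k : nat) (hk : (0 < k)%N) :
  (forall m : 'I_k,
     has_speed hk (ord_tuple k) m
       ((k%:R + 1) / ((k%:R + 2 - m.+1%:R) * (k%:R + 1 - m.+1%:R)) : R))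
  /\ (exists gamma tau : R, lcs_asymptotics hk (ord_tuple k) gamma tau)
  /\ (forall gamma tau : R, lcs_asymptotics hk (ord_tuple k) gamma tau ->
        [/\ exists2 t : nat, (0 < t)%N
              & gamma = (k%:R + t%:R ^+ 2) / (k%:R * (t%:R + 1)),
            forall t : nat, (0 < t)%N ->
              gamma <= (k%:R + t%:R ^+ 2) / (k%:R * (t%:R + 1))
          & (1 < k)%N ->
            (tau <> 0 <-> exists2 r : nat, (0 < r)%N & k = (r ^ 2 + r - 1)%N)]).
Proof.
split=> [m F0 F0bij|].
  have F0inj := bij_inj F0bij.
  have [K KP] := mean_displacement R hk m.
  apply: (@cvg_of_bounded_error _ _ _ K) => n.
  by rewrite expect_displacement.
have [c [cP cA]] := lcs_expansion R hk.
split; first by eexists; eexists; exact: cA.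
move=> gamma tau /(lcs_asymptotics_unique cA)[<- <-]; split.
- exact: gamma0_attained.
- by move=> t _; apply: gamma0_le.
(* For [k = 1] the LCS is deterministic and [tau] vanishes although [1 = 1 ^ 2 + 1 - 1], hence the
   assumption. For larger [k], [tau] is a sum of nonnegative terms, one of which is positive exactly
   when some speed equals 1. *)
move=> k1.
have k0 : k%:R != 0 :> R by rewrite pnatr_eq0 -lt0n.
apply: iff_trans (exists_speed_eq1 R hk).
have half_ge0 (i : 'I_k) : 0 <= c i / 2 by have [c0 _] := cP i; rewrite divr_ge0.
split=> [/eqP tau0|[m sm] /eqP].
  apply: contrapT => nex; move: tau0; rewrite big1 ?mul0r ?eqxx // => m _.
  have [_ /(_ k1) cm] := cP m; apply/eqP; rewrite mulf_eq0 -[c m == 0]negbK cm.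
  by apply/orP; left; apply/negP => sm; apply: nex; exists m.
rewrite mulf_eq0 invr_eq0 (negbTE k0) orbF psumr_eq0 // => /allP /(_ m).
rewrite mem_index_enum => /(_ isT) /=; have [_ /(_ k1)] := cP m.
by rewrite sm mulf_eq0 invr_eq0 pnatr_eq0 orbF => /negbTE ->.
Qed.
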